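(* Consider the linear model $Y_i=X_i^\top\beta^*+\varepsilon_i$, $i=1,\dots,n$, with $\beta^*\in\mathbb{R}^p$, where $X_1,\dots,X_n$ are iid $N(0,I_p)$ independent of $(\varepsilon_1,\dots,\varepsilon_n)$. Let $h$ be an arbitrary proper convex function, let $$\hat\beta\in\arg\min_{\beta\in\mathbb{R}^p}\ \frac1{2n}\sum_{i=1}^n(Y_i-X_i^\top\beta)^2+h(\beta),$$ and set $\sigma^*=(\frac1n\sum_{i=1}^n\varepsilon_i^2)^{1/2}$, $Z=\frac{1}{n^{1/2}\sigma^*}\sum_{i=1}^n\varepsilon_iX_i\sim N(0,I_p)$ and $\eta=\mathrm{prox}_h(\beta^*+n^{-1/2}\sigma^*Z)$. Then for every $t>0$, with probability at least $1-2\exp(-t^2/2)$, $$\Big|\ \|\hat\beta-\beta^*\|-\mathbb{E}_Z\big[\|\beta^*-\mathrm{prox}_h(\beta^*+n^{-1/2}\sigma^*Z)\|^2\big]^{1/2}\ \Big|\le\frac{\sigma^*(t+1)}{n^{1/2}}+\|\hat\beta-\eta\| ,$$ where $\mathbb{E}_Z$ denotes the expectation with respect to $Z\sim N(0,I_p)$ (with $\sigma^*$ held fixed).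
   Context: $\|\cdot\|$ is the Euclidean norm. $\mathrm{prox}_h(x)=\arg\min_{b\in\mathbb{R}^p}\frac12\|x-b\|^2+h(b)$ (minimizers are assumed to exist, and $\sigma^*>0$). The vector $\eta$ is the paper's first order expansion of $\hat\beta$, which for squared loss and $\Sigma=I_p$ is $\arg\min_\beta\ -\frac1n\sum_i\varepsilon_iX_i^\top(\beta-\beta^* )+\frac12\|\beta-\beta^*\|^2+h(\beta)$ and equals the proximal expression in the claim. *)

(* Defs.v *)
From HB Require Import structures.
From mathcomp Require Import all_boot all_order all_algebra.
From mathcomp Require Import all_classical all_reals all_analysis.

Set Implicit Arguments.
Unset Strict Implicit.
Unset Printing Implicit Defensive.

Import Order.TTheory GRing.Theory Num.Theory.
Import numFieldNormedType.Exports.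

Local Open Scope classical_set_scope.
Local Open Scope ring_scope.

Section euclidean.
Context {R : realType} {p : nat}.
Implicit Types u v : 'rV[R]_p.

Definition dot u v : R := \sum_(j < p) u 0 j * v 0 j.

(* The library norm on matrices is the sup norm, hence this definition. *)
Definition enorm u : R := Num.sqrt (\sum_(j < p) u 0 j ^+ 2).

(* Only tuples carry the product sigma-algebra in the library, so random
   vectors take values in p.-tuple R. *)
Definition tvec (x : p.-tuple R) : 'rV[R]_p := \row_(j < p) tnth x j.

End euclidean.

Section convex.
Context {R : realType} {p : nat}.
Implicit Types (f h : 'rV[R]_p -> \bar R) (x b : 'rV[R]_p).

Definition proper_fun h := (forall x, h x != -oo%E) /\ (exists x, h x != +oo%E).

Definition convex_fun h := forall (x y : 'rV[R]_p) (l : R), 0 <= l -> l <= 1 ->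
  (h (l *: x + (1 - l) *: y)%R <= l%:E * h x + (1 - l)%:E * h y)%E.

Definition argmin f : set 'rV[R]_p := [set b | forall b', (f b <= f b')%E].

Definition prox_objective h x b : \bar R :=
  ((2^-1 * enorm (x - b) ^+ 2)%:E + h b)%E.

(* Equal to 0 if there is no minimizer; for convex h there is at most one. *)
Definition prox h x : 'rV[R]_p := xget 0 (argmin (prox_objective h x)).

Definition penalized_lsq {n : nat} h (X : 'I_n -> 'rV[R]_p) (Y : 'I_n -> R) b :
    \bar R :=
  (((2 * n%:R)^-1 * \sum_(i < n) (Y i - dot (X i) b) ^+ 2)%:E + h b)%E.

End convex.

Section standard_gaussian.
Context {R : realType}.

(* normal_prob is a measure on measurableTypeR R, which is R with the same
   Borel sets but another display. *)
Definition tcons (p : nat) (xy : measurableTypeR R * p.-tuple R) :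
    p.+1.-tuple R :=
  [the p.+1.-tuple R of (xy.1 : R) :: xy.2].

Lemma measurable_tcons (p : nat) : measurable_fun setT (@tcons p).
Proof.
apply: (@measurable_cons _ _ (measurableTypeR R * p.-tuple R)%type R
  (fun xy => xy.1) p (fun xy => xy.2)).
- by move=> mT A mA; exact: (measurable_fst mT).
- exact: measurable_snd.
Qed.

HB.instance Definition _ (p : nat) :=
  isMeasurableFun.Build _ _ _ _ (@tcons p) (@measurable_tcons p).

(* N(0, I_p), the p-fold product of N(0, 1). *)
Fixpoint std_gaussian (p : nat) : probability (p.-tuple R) R :=
  match p with
  | 0 => dirac [tuple]
  | q.+1 => distribution (normal_prob 0 1 \x std_gaussian q)%E (@tcons q)
  end.

Lemma std_gaussian_box (p : nat) (A : 'I_p -> set R) :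
  (forall j, measurable (A j)) ->
  std_gaussian p [set x | forall j, A j (tnth x j)] =
  (\prod_(j < p) normal_prob 0 1 (A j))%E.
Proof.
elim: p A => [|p IH] A mA /=.
  by rewrite big_ord0 diracE mem_set//= => -[].
rewrite big_ord_recl /= /distribution /pushforward /=.
rewrite -IH// -product_measure1E//; last first.
- rewrite (_ : [set x | _] = \bigcap_(j in [set: 'I_p])
      ((fun x : p.-tuple R => tnth x j) @^-1` A (lift ord0 j))).
    apply: fin_bigcap_measurable => // j _.
    by rewrite -[X in measurable X]setTI; apply: measurable_tnth.
  by apply/seteqP; split => x /= xA j; [move=> _; exact: xA|exact: xA].
- exact: mA.
congr (_ _); apply/seteqP; split => -[a x] /=.
  move=> H; split; first by have := H ord0.
  by move=> j; have := H (lift ord0 j); rewrite tnthS.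
move=> [Aa Ax] j; case: (unliftP ord0 j) => [k|] ->.
  by rewrite tnthS; exact: Ax.
by [].
Qed.

End standard_gaussian.

Section probability_notions.
Context {d : measure_display} {T : measurableType d} {R : realType}.
Variable P : probability T R.

(* Some A i may be the whole space, so subfamilies are covered. *)
Definition mutually_independent {I : finType} {d' : measure_display}
    {T' : measurableType d'} (X : I -> T -> T') :=
  forall A : I -> set T', (forall i, measurable (A i)) ->
  P [set w | forall i, A i (X i w)] = (\prod_(i : I) P (X i @^-1` A i))%E.

Definition independent {d1 d2 : measure_display} {T1 : measurableType d1}
    {T2 : measurableType d2} (U : T -> T1) (V : T -> T2) :=
  forall A B, measurable A -> measurable B ->
  P (U @^-1` A `&` V @^-1` B) = (P (U @^-1` A) * P (V @^-1` B))%E.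

Definition has_law {d' : measure_display} {T' : measurableType d'}
    (X : {RV P >-> T'}) (mu : probability T' R) :=
  forall A, measurable A -> distribution P X A = mu A.

(* Inner formulation, so that E need not be measurable; for measurable E it
   says q <= P E. *)
Definition with_probability_at_least (q : R) (E : set T) :=
  exists A, [/\ measurable A, A `<=` E & (q%:E <= P A)%E].

End probability_notions.

Section linear_model.
Context {R : realType} {n p : nat}.
Implicit Types (X : 'I_n -> 'rV[R]_p) (eps : 'I_n -> R).

Definition noise_level eps : R :=
  Num.sqrt (n%:R^-1 * \sum_(i < n) eps i ^+ 2).

Definition noise_vector X eps : 'rV[R]_p :=
  (Num.sqrt n%:R * noise_level eps)^-1 *: \sum_(i < n) eps i *: X i.

End linear_model.

(* The function of s whose value at noise_level eps is the expectation with
   respect to Z ~ N(0, I_p) with the noise level held fixed. *)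
Definition prox_risk {R : realType} {p : nat} (n : nat)
    (h : 'rV[R]_p -> \bar R) (beta0 : 'rV[R]_p) (s : R) : R :=
  fine ('E_(std_gaussian p)[fun z =>
    (enorm (beta0 - prox h (beta0 + (s / Num.sqrt n%:R) *: tvec z)) ^+ 2)%R])%E.

(* Main.v *)
Require Import Defs.
From HB Require Import structures.
From mathcomp Require Import all_boot all_order all_algebra.
From mathcomp Require Import all_classical all_reals all_analysis.
From mathcomp Require Import measurable_realfun ring lra.
Set Implicit Arguments.
Unset Strict Implicit.
Unset Printing Implicit Defensive.
Import Order.TTheory GRing.Theory Num.Theory.
Import numFieldNormedType.Exports.
Local Open Scope classical_set_scope.
Local Open Scope ring_scope.

(** Fix the noise and put [s = sigma / sqrt n].  The error
    [F z = |prox h (beta0 + s z) - beta0|] of the proximal point is a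
    nonnegative [s]-Lipschitz function of [z], because [prox h] is
    nonexpansive ([prox_nonexpansive]).  Conditionally on the noise, [Z] is a
    standard Gaussian vector, so [|eta - beta0| = F Z] obeys the Gaussian
    concentration inequality [P (|F Z - E F| > t s) <= 2 exp (- t^2 / 2)], and
    the Poincare inequality [Var F <= s^2] gives
    [E F <= sqrt (E F^2) <= E F + s].  Hence
    [|F Z - sqrt (E F^2)| <= s (t + 1)] with the required probability
    ([gaussian_rms_concentration]), and [|betahat - eta|] enters through the
    triangle inequality only.  At [s = 0] there is nothing to prove.

    Concentration with the sharp constant and the Poincare inequality both
    follow from [E exp (a (F - E F)) <= exp (a^2 s^2 / 2)] for every real [a].
    This bound comes from the dual transport inequality: if
    [f x - g y <= l |x - y|^2 / 2] for all [x] and [y], with [l < 1], then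
    [E exp f <= exp (E g)].  It applies to [f = F - s^2 / (2 l)] and [g = F],
    and then [l] tends to 1.  In dimension one it is an instance of the
    Prekopa-Leindler inequality, whose proof is the layer-cake formula and the
    Brunn-Minkowski inequality for subsets of the line
    ([dual_transport_gauss1]); it passes to products by applying it in one
    factor at a time ([dual_transport_prod]).  It is used for bounded functions;
    truncation extends the moment bounds to all nonnegative Lipschitz functions.

    The conditional law of [Z] is found without conditioning: the pair of the
    design and the noise has a product law, so it suffices to bound the
    sections of the exceptional event at each value of the noise
    ([independent_section_bound]).  On such a section [Z] is a weighted sum of
    independent Gaussian vectors whose squared weights sum to 1, and rotation
    invariance identifies its law ([gaussian_weighted_sum_law]). *)

(** * Affine changes of variable for Lebesgue measure *)

Section affine.
Context {R : realType}.
Local Notation mu := (@lebesgue_measure R).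

Lemma measurable_affine (c d : R) :
  measurable_fun [set: measurableTypeR R] (fun x : R => c * x + d :
    measurableTypeR R).
Proof.
have : measurable_fun [set: R] (fun x : R => c * x + d).
  by apply: measurable_funD => //; exact: measurable_funM.
exact.
Qed.

Lemma lebesgue_measure_affine (c d : R) (A : set (measurableTypeR R)) :
  c != 0 -> measurable A ->
  mu A = (`|c|%:E * mu ((fun x : R => c * x + d)%R @^-1` A))%E.
Proof.
move=> c0 mA.
have mm := measurable_affine c d.
rewrite [LHS](@lebesgue_measure_unique R
  (mscale (`|c|%:nng) (pushforward mu (fun x : measurableTypeR R => (c * x +
    d)%R : measurableTypeR R))))//.
move=> _ [[a b] _ <-]; rewrite /= /mscale /= /pushforward.
have [c_gt0|c_lt0|/eqP] := ltgtP 0 c; last by rewrite eq_sym (negPf c0).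
  rewrite (_ : _ @^-1` _ = `](a - d) / c, (b - d) / c]%classic); last first.
    apply/seteqP; split=> x /=; rewrite !in_itv/= ltr_pdivrMr// ler_pdivlMr//;
      by rewrite ltrBlDr lerBrDr mulrC.
  rewrite !lebesgue_measure_itv/= !lte_fin ltr_pM2r ?invr_gt0// ltrD2r.
  case: ifPn => _; last by rewrite mule0.
  by rewrite -!EFinB -EFinM gtr0_norm//; congr EFin; field.
rewrite (_ : _ @^-1` _ = `[(b - d) / c, (a - d) / c[%classic); last first.
  apply/seteqP; split=> x /=; rewrite !in_itv/= ler_ndivrMr// ltr_ndivlMr//;
    by rewrite ltrBlDr lerBrDr mulrC andbC.
rewrite !lebesgue_measure_itv/= !lte_fin ltr_nM2r ?invr_lt0// ltrD2r.
case: ifPn => _; last by rewrite mule0.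
by rewrite -!EFinB -EFinM ltr0_norm//; congr EFin; field.
Qed.

Lemma ge0_integral_affine (c d : R) (G : R -> \bar R) :
  c != 0 -> measurable_fun [set: R] G -> (forall x, 0 <= G x)%E ->
  (\int[mu]_x G x = `|c|%:E * \int[mu]_x G (c * x + d)%R)%E.
Proof.
move=> c0 mG G0; have mm := measurable_affine c d.
rewrite -[X in _ = (_ * X)%E](@ge0_integral_pushforward _ _ _ _ _ _ mm mu setT
  G)//=.
rewrite -(ge0_integral_mscale _ measurableT (`|c|%:nng)%R)//=.
by apply: eq_measure_integral => //= A mA _; exact: lebesgue_measure_affine.
Qed.

End affine.

(** * Brunn-Minkowski inequality on the line *)

Section brunn_minkowski.
Context {R : realType}.
Local Notation mu := (@lebesgue_measure R).
Local Notation MR := (measurableTypeR R).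

Lemma measurable_preimage_affine (c d : R) (A : set MR) : measurable A ->
  measurable ((fun x : R => c * x + d : MR) @^-1` A).
Proof. by move=> mA; rewrite -[X in measurable X]setTI;
  exact: measurable_affine. Qed.

(** The translates of [A] by [min B] and of [B] by [max A] both lie in the
    sumset and meet in at most one point. *)
Lemma brunn_minkowski_compact (A B : set R) (C : set MR) :
  compact A -> compact B -> A !=set0 -> B !=set0 -> measurable C ->
  (forall a b, A a -> B b -> C (a + b)) -> (mu A + mu B <= mu C)%E.
Proof.
move=> cA cB A0 B0 mC ABC.
have [a /set_mem Aa amax] : exists2 a, a \in A & forall t, t \in A -> (t <= a).
  apply: (@compact_EVT_max _ _ id) => //.
  by apply: continuous_subspaceT => x; exact: cvg_id.
have [b /set_mem Bb bmin] : exists2 b, b \in B & forall t, t \in B -> (- t <= - b).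
  apply: (@compact_EVT_max _ _ (fun x : R => - x)) => //.
  by apply: continuous_subspaceT => x; exact: oppr_continuous.
have mA : measurable (A : set MR) by exact: compact_measurable.
have mB : measurable (B : set MR) by exact: compact_measurable.
pose S : set MR := (fun x : R => 1 * x + (- b)) @^-1` A.
pose T : set MR := (fun x : R => 1 * x + (- a)) @^-1` B.
have mS : measurable S by exact: measurable_preimage_affine.
have mT : measurable T by exact: measurable_preimage_affine.
have <- : mu S = mu A.
  by rewrite [RHS](@lebesgue_measure_affine R 1 (- b))// normr1 mul1e.
have <- : mu T = mu B.
  by rewrite [RHS](@lebesgue_measure_affine R 1 (- a))// normr1 mul1e.
have SC : S `<=` C.
  by move=> x; rewrite /S/= mul1r => Sx; have := ABC _ _ Sx Bb; rewrite subrK.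
have TC : T `<=` C.
  by move=> x; rewrite /T/= mul1r => Tx; have := ABC _ _ Aa Tx; rewrite addrC subrK.
pose p : R := a + b.
have mp : measurable ([set p] : set MR) by exact: measurable_set1.
have mup0 : mu [set p] = 0%E := lebesgue_measure_set1 p.
have TTp : (mu T <= mu (T `\ p))%E.
  rewrite -[leRHS]adde0 -[X in (_ + X)%E]mup0 -measureU//; last 2 first.
    exact: measurableD.
    by apply/seteqP; split => // x /= [[_ xp] /xp].
  apply: le_measure; rewrite ?inE//; first by apply: measurableU => //;
    exact: measurableD.
  by move=> x Tx /=; have [->|/eqP xp] := eqVneq x p; [right|left].
apply: (@le_trans _ _ (mu S + mu (T `\ p)))%E; first exact: leeD2l.
rewrite -measureU//; last 2 first.
  exact: measurableD.
  apply/seteqP; split => // x /= [Sx [Tx xp]]; apply: xp.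
  apply/eqP; rewrite eq_le; apply/andP; split.
    by have := amax _ (mem_set Sx); rewrite mul1r lerBlDr.
  by have := bmin _ (mem_set Tx); rewrite mul1r lerN2 lerBrDr addrC.
apply: le_measure; rewrite ?inE//; first by apply: measurableU => //;
  exact: measurableD.
by move=> x [/SC//|[/TC]].
Qed.

(* Inner regularity, with a compact set that is not empty. *)
Lemma inner_compact (A : set MR) (e : R) : measurable A -> (mu A < +oo)%E ->
  A !=set0 -> 0 < e ->
  exists K : set R, [/\ compact K, K !=set0, K `<=` A & (mu A <= mu K + e%:E)%E].
Proof.
move=> mA Aoo [a Aa] e0.
have [K [cK KA AKe]] := @lebesgue_regularity_inner R A e mA Aoo e0.
exists (K `|` [set a]); split.
- by apply: compactU => //; exact: compact_set1.
- by exists a; right.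
- by move=> x [/KA//|->].
have mK : measurable (K : set MR) by exact: compact_measurable.
have mAK : measurable (A `\` K : set MR) by exact: measurableD.
have ma : measurable ([set a] : set MR) by exact: measurable_set1.
apply: (@le_trans _ _ (mu K + mu (A `\` K)))%E.
  rewrite -measureU//; last by apply/seteqP; split => // x /= [? []].
  apply: le_measure; rewrite ?inE//; first exact: measurableU.
  by move=> x Ax; have [Kx|Kx] := pselect (K x); [left|right].
apply: leeD; last exact: ltW.
by apply: le_measure; rewrite ?inE//; exact: measurableU.
Qed.

Lemma brunn_minkowski (A B C : set MR) :
  measurable A -> measurable B -> measurable C ->
  (mu A < +oo)%E -> (mu B < +oo)%E -> A !=set0 -> B !=set0 ->
  (forall a b, A a -> B b -> C (a + b)) -> (mu A + mu B <= mu C)%E.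
Proof.
move=> mA mB mC Aoo Boo A0 B0 ABC; apply/lee_addgt0Pr => e e0.
have e20 : 0 < e / 2 by rewrite divr_gt0.
have [K [cK K0 KA AK]] := inner_compact mA Aoo A0 e20.
have [L [cL L0 LB BL]] := inner_compact mB Boo B0 e20.
apply: (le_trans (leeD AK BL)).
rewrite addeACA -EFinD -splitr leeD2r//.
apply: brunn_minkowski_compact => // a b Ka Lb.
by apply: ABC; [exact: KA|exact: LB].
Qed.

(** The version for a convex combination, obtained by scaling. *)
Lemma brunn_minkowski_conv (l : R) (A B C : set MR) : 0 < l -> l < 1 ->
  measurable A -> measurable B -> measurable C ->
  (mu A < +oo)%E -> (mu B < +oo)%E -> A !=set0 -> B !=set0 ->
  (forall a b, A a -> B b -> C ((1 - l) * a + l * b)) ->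
  ((1 - l)%:E * mu A + l%:E * mu B <= mu C)%E.
Proof.
move=> l0 l1 mA mB mC Aoo Boo A0 B0 ABC.
have k0 : 0 < 1 - l by rewrite subr_gt0.
have scale (c : R) (D : set MR) : 0 < c -> measurable D ->
    (c%:E * mu D = mu ((fun x : R => c^-1 * x + 0)%R @^-1` D))%E.
  move=> c0 mD; rewrite [in LHS](@lebesgue_measure_affine R c^-1 0)//; last first.
    by rewrite gt_eqF// invr_gt0.
  by rewrite muleA -EFinM gtr0_norm ?invr_gt0// divff ?gt_eqF// mul1e.
rewrite !scale//; apply: brunn_minkowski => //.
- exact: measurable_preimage_affine.
- exact: measurable_preimage_affine.
- by rewrite -scale// lte_mul_pinfty// lee_fin ltW.
- by rewrite -scale// lte_mul_pinfty// lee_fin ltW.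
- by move: A0 => [a Aa]; exists ((1 - l) * a); rewrite /= addr0 mulKf// gt_eqF.
- by move: B0 => [b Bb]; exists (l * b); rewrite /= addr0 mulKf// gt_eqF.
move=> a b /= Aa Bb; have := ABC _ _ Aa Bb.
by rewrite !addr0 !mulVKf ?gt_eqF.
Qed.

End brunn_minkowski.

(** * Prekopa-Leindler inequality on the line *)

Section prekopa_leindler.
Context {R : realType}.
Local Notation mu := (@lebesgue_measure R).
Local Notation MR := (measurableTypeR R).

Lemma measurable_superlevel (f : R -> R) (s : R) :
  measurable_fun [set: MR] f -> measurable ([set x | s < f x] : set MR).
Proof.
move=> mf; rewrite (_ : [set x | _] = setT `&` f @^-1` `]s, +oo[).
  exact: mf.
by rewrite setTI; apply/seteqP; split => x /=; rewrite in_itv/= andbT.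
Qed.

(* The region below the graph of [min f 1], above level 0. *)
Let under_graph (f : R -> R) : set (MR * MR) :=
  [set z | 0 < z.2 /\ z.2 < Num.min (f z.1) 1].

Let measurable_under_graph (f : R -> R) : measurable_fun [set: MR] f ->
  measurable (under_graph f).
Proof.
move=> mf.
have ms : measurable_fun [set: MR * MR] (fun z : MR * MR => z.2 : R).
  exact: measurable_snd.
have mf1 : measurable_fun [set: MR * MR] (fun z : MR * MR => Num.min (f z.1) 1).
  by apply: measurable_minr => //; apply: measurableT_comp => //;
    exact: measurable_fst.
have m1 : measurable_fun [set: MR * MR] (fun z : MR * MR => 0 < (z.2 : R)).
  exact: measurable_fun_ltr.
have m2 : measurable_fun [set: MR * MR] (fun z : MR * MR => (z.2 : R)
  < Num.min (f z.1) 1).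
  exact: measurable_fun_ltr.
rewrite (_ : under_graph f = (setT `&` (fun z : MR * MR => 0 < (z.2 : R))
  @^-1` [set true])
  `&` (setT `&` (fun z : MR * MR => (z.2 : R) < Num.min (f z.1) 1)
    @^-1` [set true])).
  by apply: measurableI; [exact: m1|exact: m2].
by rewrite !setTI.
Qed.

(** Layer-cake formula for the truncation of a nonnegative function at 1. *)
Lemma layer_cake (f : R -> R) : measurable_fun [set: MR] f ->
  (forall x, 0 <= f x) ->
  (\int[mu]_x (Num.min (f x) 1)%:E =
   \int[mu]_(s in `]0%R, 1%R[) mu [set x | (s < f x)%R])%E.
Proof.
move=> mf f0.
have mG := measurable_under_graph mf.
have := @indic_fubini_tonelli _ _ MR MR R mu mu _ mG.
rewrite indic_fubini_tonelli_FE// indic_fubini_tonelli_GE// => FT.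
transitivity (\int[mu]_x (mu \o xsection (under_graph f)) x)%E.
  apply: eq_integral => x _ /=.
  rewrite (_ : xsection _ _ = `]0, (Num.min (f x) 1)[%classic); last first.
    apply/seteqP; split => s; rewrite /xsection/= inE/= in_itv/=.
      by case=> -> ->.
    by move=> /andP[].
  rewrite lebesgue_measure_itv/= lte_fin.
  case: ifPn => [_|]; first by rewrite oppr0 addr0.
  rewrite -leNgt => m0; congr EFin; apply/eqP; rewrite eq_le m0/=.
  by rewrite le_min f0 ler01.
rewrite FT [RHS]integral_mkcond; apply: eq_integral => s _ /=.
rewrite patchE; case: ifPn => s01.
  congr (mu _); apply/seteqP; split => x; rewrite /ysection/= inE/=.
    by case=> _; rewrite lt_min => /andP[].
  move: s01; rewrite inE/= in_itv/= => /andP[s0 s1] sf; split => //.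
  by rewrite lt_min sf.
rewrite (_ : ysection _ _ = set0) ?measure0//.
apply/seteqP; split => // x; rewrite /ysection/= inE/= => -[s0].
rewrite lt_min => /andP[_ s1]; move: s01.
by rewrite notin_setE/= in_itv/= s0 s1; exact.
Qed.

Let measurable_superlevel_measure (f : R -> R) : measurable_fun [set: MR] f ->
  measurable_fun (`]0, 1[%classic : set MR) (fun s : R => mu [set x | s < f x]).
Proof.
move=> mf.
have mG := measurable_under_graph mf.
have := @indic_measurable_fun_fubini_tonelli_G _ _ MR MR R mu _ mG.
rewrite indic_fubini_tonelli_GE// => mGG.
apply: (eq_measurable_fun (mu \o ysection (under_graph f))); last first.
  by apply: measurable_funTS.
move=> s; rewrite inE/= in_itv/= => /andP[s0 s1]; congr (mu _).
apply/seteqP; split => x; rewrite /ysection/= inE/=.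
  by case=> _; rewrite lt_min => /andP[].
by move=> sf; split => //; rewrite lt_min sf.
Qed.

Let superlevel_fin (f : R -> R) (s : R) : measurable_fun [set: MR] f ->
  (forall x, 0 <= f x) -> (\int[mu]_x (f x)%:E < +oo)%E -> 0 < s ->
  (mu [set x | (s < f x)%R] < +oo)%E.
Proof.
move=> mf f0 foo s0.
have ms := measurable_superlevel s mf.
have : (s%:E * mu [set x | (s < f x)%R] < +oo)%E.
  apply: le_lt_trans foo.
  have -> : (s%:E * mu [set x | (s < f x)%R] =
      \int[mu]_x (s * \1_[set x | s < f x] x)%:E)%E.
    under eq_integral do rewrite EFinM.
    rewrite ge0_integralZl//=; last 2 first.
      by apply/measurable_EFinP; exact: measurable_indic.
      by rewrite lee_fin ltW.
    by rewrite integral_indic// setIT.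
  apply: ge0_le_integral => //=.
  - by move=> x _; rewrite lee_fin mulr_ge0// ltW.
  - by apply/measurable_EFinP; apply: measurable_funM => //;
    exact: measurable_indic.
  - exact/measurable_EFinP.
  - move=> x _; rewrite lee_fin indicE.
    case: (boolP (x \in _)) => [|_]; last by rewrite mulr0.
    by rewrite inE/= mulr1 => /ltW.
rewrite -[X in (_ * X < _)%E -> _]/(mu _).
by rewrite -lte_pdivlMl// => /lt_le_trans; apply; rewrite leey.
Qed.

(** One-dimensional Prekopa-Leindler inequality, for functions [u] and [v] whose
    supremum is 1.  It is additive rather than multiplicative because the
    superlevel sets of [u] and [v] are then nonempty for the same levels. *)
Lemma prekopa_leindler_sup1 (l : R) (u v h : R -> R) : 0 < l -> l < 1 ->
  measurable_fun [set: MR] u -> measurable_fun [set: MR] v ->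
  measurable_fun [set: MR] h ->
  (forall x, 0 <= u x <= 1) -> (forall x, 0 <= v x <= 1) ->
  (forall x, 0 <= h x) ->
  (\int[mu]_x (u x)%:E < +oo)%E -> (\int[mu]_x (v x)%:E < +oo)%E ->
  (forall s, s < 1 -> exists x, s < u x) ->
  (forall s, s < 1 -> exists x, s < v x) ->
  (forall s x y, 0 < s -> s < u x -> s < v y -> s < h ((1 - l) * x + l * y)) ->
  ((1 - l)%:E * \int[mu]_x (u x)%:E + l%:E * \int[mu]_x (v x)%:E
   <= \int[mu]_x (h x)%:E)%E.
Proof.
move=> l0 l1 mu_ mv mh u01 v01 h0 uoo voo u1 v1 uvh.
have k0 : 0 < 1 - l by rewrite subr_gt0.
have uge0 x : 0 <= u x by have /andP[] := u01 x.
have vge0 x : 0 <= v x by have /andP[] := v01 x.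
have min1 (f : R -> R) : (forall x, 0 <= f x <= 1) ->
    (\int[mu]_x (f x)%:E = \int[mu]_x (Num.min (f x) 1)%:E)%E.
  move=> f01; apply: eq_integral => x _; congr EFin.
  by have /andP[_ fx1] := f01 x; rewrite min_l.
apply: (@le_trans _ _ (\int[mu]_x (Num.min (h x) 1)%:E)%E); last first.
  apply: ge0_le_integral => //=.
  - by move=> x _; rewrite lee_fin le_min h0 ler01.
  - by apply/measurable_EFinP; exact: measurable_minr.
  - exact/measurable_EFinP.
  - by move=> x _; rewrite lee_fin ge_min lexx.
rewrite (min1 u)// (min1 v)// !layer_cake//.
rewrite -!ge0_integralZl//=; [|exact: measurable_superlevel_measure|
  by rewrite lee_fin ltW|exact: measurable_superlevel_measure|by rewrite
    lee_fin ltW].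
rewrite -ge0_integralD//=; last 4 first.
- by move=> s _; rewrite mule_ge0// lee_fin ltW.
- by apply: emeasurable_funM => //; exact: measurable_superlevel_measure.
- by move=> s _; rewrite mule_ge0// lee_fin ltW.
- by apply: emeasurable_funM => //; exact: measurable_superlevel_measure.
apply: ge0_le_integral => //=.
- by move=> s _; rewrite adde_ge0// mule_ge0// lee_fin ltW.
- by apply: emeasurable_funD; apply: emeasurable_funM => //;
  exact: measurable_superlevel_measure.
- exact: measurable_superlevel_measure.
move=> s /=; rewrite in_itv/= => /andP[s0 s1].
apply: brunn_minkowski_conv => //.
- exact: measurable_superlevel.
- exact: measurable_superlevel.
- exact: measurable_superlevel.
- exact: superlevel_fin.
- exact: superlevel_fin.
- exact: u1.
- exact: v1.
- by move=> a b; exact: uvh.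
Qed.

End prekopa_leindler.

(** * Integration against a density *)

(** A measure [nu] with density [g] with respect to [mu]. *)
Section density.
Context d (T : measurableType d) (R : realType).
Variables (mu nu : {measure set T -> \bar R}) (g : T -> R).
Hypotheses (mg : measurable_fun setT g) (g0 : forall x, 0 <= g x).
Hypothesis nuE : forall A, measurable A ->
  nu A = (\int[mu]_(x in A) (g x)%:E)%E.

Let integral_density_indic (A : set T) : measurable A ->
  (\int[nu]_x (\1_A x)%:E = \int[mu]_x ((\1_A x)%:E * (g x)%:E))%E.
Proof.
move=> mA; rewrite integral_indic// setIT nuE// integral_mkcond.
apply: eq_integral => x _; rewrite patchE indicE.
by case: ifPn => xA; rewrite ?mul1e ?mul0e.
Qed.

Import HBNNSimple.

Let integral_density_nnsfun (f : {nnsfun T >-> R}) :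
  (\int[nu]_x (f x)%:E = \int[mu]_x ((f x)%:E * (g x)%:E))%E.
Proof.
under [LHS]eq_integral do rewrite fimfunE -fsumEFin//.
rewrite [LHS]ge0_integral_fsum//; last 2 first.
  - by move=> r; exact/measurable_EFinP/measurableT_comp.
  - by move=> n x _; rewrite EFinM nnfun_muleindic_ge0.
under [RHS]eq_integral.
  move=> x xD; rewrite fimfunE -fsumEFin// muleC ge0_mule_fsumr; last first.
    by move=> r; rewrite EFinM nnfun_muleindic_ge0.
  over.
rewrite [RHS]ge0_integral_fsum//; last 2 first.
  - move=> r; apply: emeasurable_funM; first exact/measurable_EFinP.
    exact/measurable_EFinP/measurableT_comp.
  - move=> n x _; apply: mule_ge0; first by rewrite lee_fin.
    by rewrite EFinM nnfun_muleindic_ge0.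
apply: eq_fsbigr => r _.
rewrite integralZl_indic_nnsfun//= integral_density_indic//.
have [r0|r0] := leP 0 r.
  rewrite -ge0_integralZl//.
  - by apply: eq_integral => x _; rewrite EFinM (muleC (g x)%:E) muleA.
  - apply: emeasurable_funM; last exact/measurable_EFinP.
    exact/measurable_EFinP/measurable_indic.
  - by move=> x _; rewrite mule_ge0// lee_fin.
rewrite preimage_nnfun0// indic0 integral0_eq ?mule0; last first.
  by move=> x _; rewrite mul0e.
by rewrite integral0_eq// => x _; rewrite mulr0 mule0.
Qed.

Lemma ge0_integral_density (f : T -> \bar R) :
  measurable_fun setT f -> (forall x, 0 <= f x)%E ->
  (\int[nu]_x f x = \int[mu]_x (f x * (g x)%:E))%E.
Proof.
move=> mf f0; pose f_ := nnsfun_approx measurableT mf.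
transitivity (lim (\int[nu]_x (f_ n x)%:E @[n --> \oo])%E).
  rewrite -monotone_convergence//=.
  - by apply: eq_integral => x _; apply/esym/cvg_lim => //=;
    exact: cvg_nnsfun_approx.
  - by move=> n; exact/measurable_EFinP/measurable_funTS.
  - by move=> n ? _; rewrite lee_fin.
  - by move=> ? _ ? ? mn; rewrite lee_fin; exact/lefP/nd_nnsfun_approx.
transitivity (lim (\int[mu]_x ((f_ n x)%:E * (g x)%:E) @[n --> \oo])%E).
  by apply: congr_lim; apply/funext => n /=; exact: integral_density_nnsfun.
rewrite -monotone_convergence//=.
- apply: eq_integral => x _; apply/cvg_lim => //=.
  by apply: cvgeZr => //; exact: cvg_nnsfun_approx.

- move=> n; apply: emeasurable_funM; last exact/measurable_EFinP.
  exact/measurable_EFinP/measurable_funTS.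
- by move=> n x _; rewrite mule_ge0// lee_fin.
- move=> x _ a b ab; rewrite lee_wpmul2r ?lee_fin//.
  exact/lefP/nd_nnsfun_approx.
Qed.

End density.

(** * Transport inequalities in dual form *)

Section exp_convexity.
Context {R : realType}.

Lemma expR_tangent (m x : R) : expR m * (1 + (x - m)) <= expR x.
Proof.
have -> : expR x = expR m * expR (x - m) by rewrite -expRD addrC subrK.
by rewrite ler_pM2l ?expR_gt0// expR_ge1Dx.
Qed.

Lemma expR_convex2 (k l x y : R) : 0 <= k -> 0 <= l -> k + l = 1 ->
  expR (k * x + l * y) <= k * expR x + l * expR y.
Proof.
move=> k0 l0 kl; set m := k * x + l * y.
have hx := expR_tangent m x; have hy := expR_tangent m y.
have : k * (expR m * (1 + (x - m))) + l * (expR m * (1 + (y - m)))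
    <= k * expR x + l * expR y by rewrite lerD// ler_wpM2l.
suff -> : k * (expR m * (1 + (x - m))) + l * (expR m * (1 + (y - m))) = expR m.
  by [].
rewrite /m; have -> : l = 1 - k by rewrite -kl; ring.
by ring.
Qed.

End exp_convexity.

Section transport_inequality.
Context {d} {T : measurableType d} {R : realType}.

(** The dual form of a transport-entropy inequality for the cost [c]: its
    instances for [f = F - L^2 / (2 l)] and [g = F], with [c] a quadratic cost,
    are Gaussian bounds on the exponential moments of [F].  It is required for
    bounded functions only, with a common bound [M], so that all integrals are
    finite and real-valued. *)
Definition dual_transport_ineq (nu : probability T R) (c : T -> T -> R) :=
  forall (f g : T -> R) (M : R), measurable_fun setT f -> measurable_fun setT g ->
  (forall x, `|f x| <= M) -> (forall x, `|g x| <= M) ->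
  (forall x y, f x - g y <= c x y) ->
  \int[nu]_x expR (f x) <= expR (\int[nu]_x g x).

Lemma integrable_bounded (nu : probability T R) (f : T -> R) (M : R) :
  measurable_fun setT f -> (forall x, `|f x| <= M) ->
  nu.-integrable setT (EFin \o f).
Proof.
move=> mf fM; apply: measurable_bounded_integrable => //.
  by apply: le_lt_trans (probability_le1 nu measurableT) _; rewrite ltry.
exists M; split; first exact: num_real.
by move=> x Mx t _ /=; apply: le_trans (fM t) (ltW Mx).
Qed.

Lemma expR_bounded (f : T -> R) (M : R) : (forall x, `|f x| <= M) ->
  forall x, `|expR (f x)| <= expR M.
Proof.
move=> fM x; rewrite ger0_norm ?expR_ge0// ler_expR.
exact: le_trans (ler_norm _) (fM x).
Qed.

(** Jensen's inequality for the exponential. *)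
Lemma expR_Rintegral_le (nu : probability T R) (f : T -> R) (M : R) :
  measurable_fun setT f -> (forall x, `|f x| <= M) ->
  expR (\int[nu]_x f x) <= \int[nu]_x expR (f x).
Proof.
move=> mf fM; set m := \int[nu]_x f x.
have fi := integrable_bounded nu mf fM.
have ei : nu.-integrable setT (EFin \o (fun x => expR (f x))).
  apply: (@integrable_bounded _ _ (expR M)); first exact: measurableT_comp.
  exact: expR_bounded.
have ci (a : R) : nu.-integrable setT (EFin \o (fun=> a)).
  exact: (@integrable_bounded _ _ `|a|).
have zi : nu.-integrable setT (EFin \o (fun x => expR m * f x)).
  apply: (@integrable_bounded _ _ (expR m * M)); first exact: measurable_funM.
  by move=> x; rewrite normrM ger0_norm ?expR_ge0// ler_wpM2l// expR_ge0.
have -> : expR m = \int[nu]_x (expR m * (1 - m) + expR m * f x).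
  rewrite RintegralD//=.
  rewrite Rintegral_cst//= RintegralZl// -/m probability_setT/=.
  by ring.
apply: le_Rintegral => //=.
  exact: (integrableD measurableT (ci _) zi).
by move=> x _; apply: le_trans (expR_tangent m (f x)); rewrite le_eqVlt;
  apply/orP; left; apply/eqP; ring.
Qed.

End transport_inequality.

(** * Transport inequality for the one-dimensional Gaussian measure *)

Section gaussian_transport_1d.
Context {R : realType}.
Local Notation mu := (@lebesgue_measure R).
Local Notation MR := (measurableTypeR R).
Local Notation gauss := (normal_prob (0 : R) 1).

Lemma normal_pdf01E (x : R) :
  normal_pdf 0 1 x = normal_peak 1 * expR (- (x ^+ 2 / 2)).
Proof.
rewrite normal_pdfE ?oner_eq0// /normal_fun subr0 expr1n.
by congr (_ * expR _); rewrite mulNr.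
Qed.

Lemma normal_peak1_gt0 : 0 < normal_peak (1 : R).
Proof. by rewrite normal_peak_gt0// oner_eq0. Qed.

Lemma ge0_integral_normal (f : MR -> \bar R) :
  measurable_fun setT f -> (forall x, 0 <= f x)%E ->
  (\int[gauss]_x f x = \int[mu]_x (f x * (normal_pdf 0 1 x)%:E))%E.
Proof.
move=> mf f0; apply: ge0_integral_density => //.
- exact: measurable_normal_pdf.
- by move=> x; exact: normal_pdf_ge0.
Qed.

(* The exponent of [h] in the Prekopa-Leindler inequality is minus half the
   square of the convex combination. *)
Let exponent_conv (l f g x y : R) : 0 < l -> l < 1 ->
  f - g <= l / 2 * (x - y) ^+ 2 ->
  (1 - l) * (f - x ^+ 2 / 2) + l * (- ((1 - l) / l * g) - y ^+ 2 / 2)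
  <= - (((1 - l) * x + l * y) ^+ 2 / 2).
Proof.
move=> l0 l1 fg; have k0 : 0 <= 1 - l by rewrite subr_ge0 ltW.
have := ler_wpM2l k0 fg => {}fg.
have -> : (1 - l) * (f - x ^+ 2 / 2) + l * (- ((1 - l) / l * g) - y ^+ 2 / 2) =
  (1 - l) * (f - g) - ((1 - l) * x ^+ 2 + l * y ^+ 2) / 2.
  by field; rewrite gt_eqF.
apply: (@le_trans _ _ ((1 - l) * (l / 2 * (x - y) ^+ 2) - ((1 - l) * x ^+ 2 +
  l * y ^+ 2) / 2)).
  by rewrite lerD2r.
by rewrite le_eqVlt; apply/orP; left; apply/eqP; field.
Qed.

Let measurable_expR_quad (a : R -> R) (A : R) : measurable_fun [set: R] a ->
  measurable_fun [set: MR] (fun x : MR => expR (a x - x ^+ 2 / 2 - A)).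
Proof.
move=> ma; have : measurable_fun [set: R] (fun x :
  R => expR (a x - x ^+ 2 / 2 - A)).
  apply: measurableT_comp => //; apply: measurable_funB => //.
  by apply: measurable_funB => //; apply: measurable_funM => //;
    exact: exprn_measurable.
exact.
Qed.

Let integral_expR_quad (a : R -> R) (M A : R) : measurable_fun [set: R] a ->
  (forall x, `|a x| <= M) ->
  (\int[mu]_x (expR (a x - x ^+ 2 / 2 - A))%:E =
   (expR (- A) / normal_peak 1 * \int[gauss]_x expR (a x))%:E)%E.
Proof.
move=> ma aM.
have me : measurable_fun [set: MR] (fun x => expR (a x)).
  by apply: measurableT_comp => //.
have ei : gauss.-integrable setT (EFin \o (fun x => expR (a x))).
  by apply: (@integrable_bounded _ _ _ _ _ (expR M)) => //; exact: expR_bounded.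
rewrite EFinM /Rintegral fineK; last exact: integrable_fin_num.
rewrite ge0_integral_normal//; last exact/measurable_EFinP.
rewrite -ge0_integralZl//=; last 3 first.
- apply: emeasurable_funM; first exact/measurable_EFinP.
  by apply/measurable_EFinP; exact: measurable_normal_pdf.
- by move=> x _; rewrite mule_ge0// lee_fin ?expR_ge0 ?normal_pdf_ge0.
- by rewrite lee_fin divr_ge0 ?expR_ge0// normal_peak_ge0.
apply: eq_integral => x _; rewrite -!EFinM; congr EFin.
rewrite normal_pdf01E.
have -> : a x - x ^+ 2 / 2 - A = - A + a x + (- (x ^+ 2 / 2)) by ring.
rewrite !expRD; field.
by rewrite gt_eqF// normal_peak1_gt0.
Qed.

(* The normalization of the exponents to supremum 0. *)
Let sup_quad (a : R -> R) (M : R) : (forall x, `|a x| <= M) ->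
  exists A : R, (forall x, a x - x ^+ 2 / 2 <= A) /\
    (forall s, s < 1 -> exists x, s < expR (a x - x ^+ 2 / 2 - A)).
Proof.
move=> aM; pose S := range (fun x => a x - x ^+ 2 / 2).
have hS : has_sup S.
  split; first by exists (a 0 - 0 ^+ 2 / 2); exists 0.
  exists M => _ [x _ <-].
  have : 0 <= x ^+ 2 by exact: sqr_ge0.
  have := aM x; rewrite ler_norml => /andP[_ ? ?]; lra.
exists (sup S); split => [x|s s1].
  by apply: ub_le_sup; [case: hS|exists x].
have [s0|s0] := leP s 0; first by exists 0; rewrite (le_lt_trans s0)// expR_gt0.
have lns : 0 < - ln s by rewrite oppr_gt0 ln_lt0// s0 s1.
have [_ [x _ <-]] := sup_adherent lns hS.
rewrite opprK => h; exists x.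
rewrite -[ltLHS]lnK ?posrE// ltr_expR; lra.
Qed.

(** One-dimensional case, with a constant [l < 1] in the cost, which is the
    interpolation parameter in the Prekopa-Leindler inequality. *)
Lemma dual_transport_gauss1 (l : R) : 0 < l -> l < 1 ->
  dual_transport_ineq gauss (fun x y : MR => l / 2 * (x - y : R) ^+ 2).
Proof.
move=> l0 l1 f g M mf mg fM gM fg.
have k0 : 0 < 1 - l by rewrite subr_gt0.
(* [g] enters as [exp (- e g)], where [l e = 1 - l]; by Jensen its integral is
   at least [exp (- e G)], with [G] the mean of [g]. *)
pose e := (1 - l) / l; have e0 : 0 < e by rewrite divr_gt0.
pose b x := - (e * g x).
have mb : measurable_fun [set: R] b.
  by apply: measurableT_comp => //; exact: measurable_funM.
have bM x : `|b x| <= e * M.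
  by rewrite normrN normrM gtr0_norm// ler_wpM2l// ltW.
have [A [uA Asup]] := sup_quad fM.
have [B [vB Bsup]] := sup_quad bM.
pose C := (1 - l) * A + l * B.
have PL := @prekopa_leindler_sup1 R l
  (fun x => expR (f x - x ^+ 2 / 2 - A)) (fun x => expR (b x - x ^+ 2 / 2 - B))
  (fun x => expR (0 - x ^+ 2 / 2 - C)).
have {PL} : (((1 - l) * (expR (- A) / normal_peak 1 * \int[gauss]_x expR (f x))
    + l * (expR (- B) / normal_peak 1 * \int[gauss]_x expR (b x)))%:E
    <= (expR (- C) / normal_peak 1 * \int[gauss]_x expR (cst 0 x))%:E)%E.
  rewrite -(@integral_expR_quad (cst 0) 0)//; last by move=> x; rewrite normr0.
  rewrite EFinD (EFinM (1 - l)) (EFinM l) -(@integral_expR_quad f M)//.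
  rewrite -(@integral_expR_quad b (e * M))//.
  apply: PL => //.
  - exact: measurable_expR_quad.
  - exact: measurable_expR_quad.
  - exact: (@measurable_expR_quad (cst 0)).
  - by move=> x; rewrite expR_ge0/= -[leRHS]expR0 ler_expR subr_le0.
  - by move=> x; rewrite expR_ge0/= -[leRHS]expR0 ler_expR subr_le0.
  - by rewrite (@integral_expR_quad f M)// ltry.
  - by rewrite (@integral_expR_quad b (e * M))// ltry.
  - move=> s x y s0; rewrite -[s in s < _ -> s < _ ->
    s < _]lnK ?posrE// !ltr_expR => hx hy.
    have := exponent_conv l0 l1 (fg x y); rewrite -/e -/(b y).
    have := ltr_pM2l k0 (ln s) (f x - x ^+ 2 / 2 - A); rewrite hx => hx'.
    have := ltr_pM2l l0 (ln s) (b y - y ^+ 2 / 2 - B); rewrite hy => hy'.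
    rewrite /C; lra.
rewrite lee_fin /=.
under [X in _ <= _ * X]eq_Rintegral do rewrite expR0.
rewrite Rintegral_cst//= probability_setT/= !mul1r mulr1.
set U := \int[gauss]_x expR (f x); set V := \int[gauss]_x expR (b x).
set G := \int[gauss]_x g x => PL.
have {}PL : (1 - l) * (expR (- A) * U) + l * (expR (- B) * V) <= expR (- C).
  have np : 0 < (normal_peak (1 : R))^-1.
    by rewrite invr_gt0; exact: normal_peak1_gt0.
  rewrite -(ler_pM2r np).
  by apply: le_trans PL; rewrite le_eqVlt; apply/orP; left; apply/eqP; ring.
have gi := integrable_bounded gauss mg gM.
have VG : expR (- (e * G)) <= V.
  have -> : - (e * G) = \int[gauss]_x b x.
    rewrite /b; under eq_Rintegral do rewrite -mulNr.
    by rewrite RintegralZl// mulNr.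
  exact: (@expR_Rintegral_le _ _ _ gauss b (e * M)).
have [U0|U0] := leP U 0; first by apply: (le_trans U0); rewrite expR_ge0.
rewrite -[leLHS]lnK ?posrE// ler_expR; set al := ln U.
have : expR ((1 - l) * (al - A) + l * (- (e * G) - B)) <= expR (- C).
  apply: le_trans PL.
  apply: (le_trans (expR_convex2 _ _ (ltW k0) (ltW l0) _)); first by ring.
  rewrite !expRD lnK ?posrE// lerD// ler_wpM2l ?(ltW k0) ?(ltW l0)//.
    by rewrite mulrC.
  by rewrite mulrC ler_wpM2l// expR_ge0.
rewrite ler_expR /C => H.
have : (1 - l) * (al - G) <= 0.
  have -> : (1 - l) * (al - G) = (1 - l) * (al - A) + l * (- (e * G) - B)
     + ((1 - l) * A + l * B) by rewrite /e; field; rewrite gt_eqF.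
  lra.
by rewrite pmulr_rle0// subr_le0.
Qed.

End gaussian_transport_1d.

(** * Products and the Gaussian measure in any dimension *)

Section tensorization.
Context {d1 d2} {T1 : measurableType d1} {T2 : measurableType d2} {R : realType}.
Variables (nu1 : probability T1 R) (nu2 : probability T2 R).

Section fubini_bounded.
Variables (F : T1 * T2 -> R) (M : R).
Hypotheses (mF : measurable_fun setT F) (FM : forall z, `|F z| <= M).

Let Fi : (nu1 \x nu2)%E.-integrable setT (EFin \o F).
Proof. exact: (@integrable_bounded _ _ _ (nu1 \x nu2)%E _ M). Qed.

Lemma measurable_section2 (y : T2) : measurable_fun setT (fun x => F (x, y)).
Proof. exact: measurableT_comp. Qed.

Let section_integrable (y : T2) :
  nu1.-integrable setT (EFin \o (fun x => F (x, y))).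
Proof.
apply: (@integrable_bounded _ _ _ _ _ M); first exact: measurable_section2.
by move=> x; exact: FM.
Qed.

Let sectionE : (fun y => (\int[nu1]_x F (x, y))%:E) = fubini_G nu1 (EFin \o F).
Proof.
by apply/funext => y; rewrite /Rintegral fineK//;
  exact: integrable_fin_num (section_integrable y).
Qed.

Lemma measurable_Rintegral_section : measurable_fun setT
  (fun y => \int[nu1]_x F (x, y)).
Proof.
by apply/measurable_EFinP; rewrite /comp sectionE;
  exact: (@measurable_fubini_G _ _ _ _ _ nu1 nu2).
Qed.

Lemma Rintegral_prod :
  \int[(nu1 \x nu2)%E]_z F z = \int[nu2]_y \int[nu1]_x F (x, y).
Proof.
rewrite /Rintegral -(@integral21_prod_meas1 _ _ _ _ _ nu1 nu2)//; congr fine.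
by apply: eq_integral => y _; rewrite -sectionE.
Qed.

Lemma Rintegral_section_bounded (y : T2) : `|\int[nu1]_x F (x, y)| <= M.
Proof.
apply: (le_trans (le_normr_Rintegral _ (section_integrable y))) => //.
have -> : M = \int[nu1]_x (cst M x).
  by rewrite Rintegral_cst//= probability_setT mulr1.
apply: le_Rintegral => //=.
- apply: (@integrable_bounded _ _ _ _ _ M); last by move=> x; rewrite normr_id.
  by apply: measurableT_comp => //; exact: measurable_section2.
- exact: (@integrable_bounded _ _ _ _ _ `|M|).
Qed.

End fubini_bounded.

(** The inequality for [nu1], in the first coordinate with the second one fixed
    at [x] in [f] and at [y] in [g], says that the functions
    [ln (\int exp (f (., x)))] and [\int g (., y)] satisfy the hypothesis of the
    inequality for [nu2]. *)
Lemma dual_transport_prod (c1 : T1 -> T1 -> R) (c2 : T2 -> T2 -> R) :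
  dual_transport_ineq nu1 c1 -> dual_transport_ineq nu2 c2 ->
  dual_transport_ineq (nu1 \x nu2)%E (fun x y => c1 x.1 y.1 + c2 x.2 y.2).
Proof.
move=> H1 H2 f g M mf mg fM gM fg.
have mef : measurable_fun setT (fun z => expR (f z)) by exact: measurableT_comp.
have efM := expR_bounded fM.
pose E y := \int[nu1]_x expR (f (x, y)).
have lb y : expR (- M) <= E y.
  apply: (@le_trans _ _ (expR (\int[nu1]_x f (x, y)))).
    rewrite ler_expR.
    by have := Rintegral_section_bounded mf fM y; rewrite ler_norml => /andP[].
  by apply: (@expR_Rintegral_le _ _ _ _ _ M) => //; exact: measurable_section2.
have E0 y : 0 < E y by apply: lt_le_trans (lb y); exact: expR_gt0.
have ub y : E y <= expR M.
  by have := Rintegral_section_bounded mef efM y; rewrite ler_norml => /andP[].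
rewrite (Rintegral_prod mef efM) (Rintegral_prod mg gM).
rewrite [leLHS](_ : _ = \int[nu2]_y expR (ln (E y))); last first.
  by apply: eq_Rintegral => y _; rewrite lnK// posrE.
apply: (H2 _ _ M).
- by apply: measurableT_comp => //; exact: (measurable_Rintegral_section mef efM).
- exact: (measurable_Rintegral_section mg gM).
- move=> y; rewrite ler_norml; apply/andP; split.
    by rewrite -[leLHS]expRK ler_ln ?posrE ?expR_gt0// lb.
  by rewrite -[leRHS]expRK ler_ln ?posrE ?expR_gt0// ub.
- exact: Rintegral_section_bounded.
move=> x y.
have := H1 (fun t => f (t, x) - c2 x y) (fun t => g (t, y)) (M + `|c2 x y|).
have m1 : measurable_fun setT (fun t => f (t, x)) by exact: measurable_section2.
have -> : \int[nu1]_t expR (f (t, x) - c2 x y) = E x * expR (- c2 x y).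
  under eq_Rintegral do rewrite expRD.
  rewrite RintegralZr//; apply: (@integrable_bounded _ _ _ _ _ (expR M)).
    exact: measurableT_comp.
  by move=> t; exact: efM.
move=> H.
have {H} : E x * expR (- c2 x y) <= expR (\int[nu1]_t g (t, y)).
  apply: H.
  - by apply: measurable_funB.
  - exact: measurable_section2.
  - by move=> t; apply: (le_trans (ler_normB _ _)); rewrite lerD2r.
  - by move=> t; apply: (le_trans (gM _)); rewrite lerDl.
  - by move=> a b; have := fg (a, x) (b, y) => /= h; lra.
rewrite -{1}(@lnK _ (E x)) ?posrE// -expRD ler_expR => h; lra.
Qed.

End tensorization.

Section pushforward.
Context {d1 d2} {T1 : measurableType d1} {T2 : measurableType d2} {R : realType}.

Lemma Rintegral_distribution (nu : probability T1 R) (X : {mfun T1 >-> T2})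
    (f : T2 -> R) (M : R) : measurable_fun setT f -> (forall x, `|f x| <= M) ->
  \int[distribution nu X]_x f x = \int[nu]_x f (X x).
Proof.
move=> mf fM; rewrite /Rintegral integral_distribution//.
  exact/measurable_EFinP.
apply: (@integrable_bounded _ _ _ nu (f \o X) M) => //.
  exact: measurableT_comp.
by move=> x; exact: fM.
Qed.

Lemma dual_transport_distribution (nu : probability T1 R) (X : {mfun T1 >-> T2})
    (c : T1 -> T1 -> R) (c' : T2 -> T2 -> R) :
  (forall x y, c' (X x) (X y) = c x y) ->
  dual_transport_ineq nu c -> dual_transport_ineq (distribution nu X) c'.
Proof.
move=> cE H f g M mf mg fM gM fg.
rewrite (Rintegral_distribution _ _ mg gM).
rewrite (@Rintegral_distribution _ _ (fun x => expR (f x)) (expR M)); last 2 first.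
- exact: measurableT_comp.
- exact: expR_bounded.
apply: (H _ _ M) => //; [exact: measurableT_comp|exact: measurableT_comp|].
by move=> x y; rewrite -cE.
Qed.

End pushforward.

Section gaussian_transport.
Context {R : realType}.

Lemma enorm_sqr (p : nat) (u : 'rV[R]_p) : enorm u ^+ 2 = \sum_(j < p) u 0 j ^+ 2.
Proof. by rewrite sqr_sqrtr// sumr_ge0// => j _; rewrite sqr_ge0. Qed.

Lemma enorm_sqr_tcons (p : nat) (a b : R * p.-tuple R) :
  enorm (tvec (tcons a) - tvec (tcons b)) ^+ 2 =
  (a.1 - b.1) ^+ 2 + enorm (tvec a.2 - tvec b.2) ^+ 2.
Proof.
rewrite !enorm_sqr big_ord_recl !mxE; congr (_ + _).
by apply: eq_bigr => j _; rewrite !mxE !tnthS.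
Qed.

Lemma dual_transport_gauss (p : nat) (l : R) : 0 < l -> l < 1 ->
  dual_transport_ineq (std_gaussian p)
    (fun x y => l / 2 * enorm (tvec x - tvec y) ^+ 2).
Proof.
move=> l0 l1; elim: p => [|p IH] /=.
  move=> f g M mf mg fM gM fg.
  rewrite /Rintegral !integral_dirac//; [|exact/measurable_EFinP|
    by apply/measurable_EFinP; exact: measurableT_comp].
  rewrite !diracE !mem_set// !mul1e/= ler_expR.
  have := fg [tuple] [tuple]; rewrite subrr enorm_sqr big1 ?mulr0;
    first by rewrite subr_le0.
  by move=> [].
apply: (dual_transport_distribution _ (dual_transport_prod
  (dual_transport_gauss1 l0 l1) IH)).
by move=> x y /=; rewrite enorm_sqr_tcons mulrDr.
Qed.

End gaussian_transport.

(** * Measurability of Lipschitz functions *)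

Section lipschitz_measurability.
Context {R : realType} {p : nat}.
Implicit Types x y : p.-tuple R.

Lemma enorm_ge0 (u : 'rV[R]_p) : 0 <= enorm u.
Proof. exact: sqrtr_ge0. Qed.

Lemma enorm_le_sum (u : 'rV[R]_p) : enorm u <= \sum_(j < p) `|u 0 j|.
Proof.
have S0 : 0 <= \sum_(j < p) `|u 0 j| by apply: sumr_ge0 => j _.
rewrite -[leRHS](ger0_norm S0) -sqrtr_sqr ler_wsqrtr// expr2 mulr_suml.
apply: ler_sum => j _; rewrite -real_normK ?num_real// expr2 ler_wpM2l//.
by rewrite (bigD1 j)//= lerDl sumr_ge0.
Qed.

(** [F] is [L]-Lipschitz for the Euclidean norm, on tuples because these carry the
    product sigma-algebra. *)
Definition lipschitz_enorm (L : R) (F : p.-tuple R -> R) :=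
  forall x y, `|F x - F y| <= L * enorm (tvec x - tvec y).

(** The infimal convolution of [F] with its modulus over rational points
    recovers [F], so that [F < c] is a countable union. *)
Lemma measurable_lipschitz (L : R) (F : p.-tuple R -> R) : 0 <= L ->
  lipschitz_enorm L F -> measurable_fun setT F.
Proof.
move=> L0 FL.
have FL1 x y : `|F x - F y| <= L * \sum_(j < p) `|tnth x j - tnth y j|.
  apply: le_trans (FL x y) _; apply: ler_wpM2l => //.
  apply: (le_trans (enorm_le_sum _)); rewrite le_eqVlt; apply/orP; left.
  by apply/eqP/eq_bigr => j _; rewrite !mxE.
pose rt (q : p.-tuple rat) : p.-tuple R := map_tuple ratr q.
pose G (q : p.-tuple rat) x := F (rt q) + L * \sum_(j < p)
  `|tnth x j - tnth (rt q) j|.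
have mG q : measurable_fun setT (G q).
  apply: measurable_funD => //; apply: measurable_funM => //.
  apply: measurable_sum => j; apply: measurableT_comp => //.
  by apply: measurable_funB => //; exact: measurable_tnth.
apply: (measurability _ (RGenInftyO.measurableE R)) => //.
move=> _ [_ [c ->] <-]; rewrite setTI.
rewrite (_ : _ @^-1` _ = \bigcup_(q in [set: p.-tuple rat]) (G q @^-1` `]-oo, c[)).
  apply: countable_bigcupT_measurable; first exact: countableP.
  by move=> q; rewrite -[X in measurable X]setTI; exact: mG.
apply/seteqP; split => x /=; rewrite in_itv/=; last first.
  move=> [q _]; rewrite /= in_itv/=; apply: le_lt_trans.
  have := FL1 x (rt q); rewrite /G ler_norml => /andP[_]; lra.
move=> Fc.
(* A rational point at distance [de] in each coordinate is close enough, since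
   [F] is then off by at most half of the gap [c - F x]. *)
pose de := (c - F x) / (2 * (L + 1) * p.+1%:R).
have L1 : 0 < L + 1 by rewrite ltr_pwDr.
have de0 : 0 < de.
  by rewrite divr_gt0 ?subr_gt0// !mulr_gt0.
have /choice[r rP] : forall j : 'I_p, exists r : rat,
    `|tnth x j - ratr r| < de.
  move=> j; have : tnth x j < tnth x j + de by rewrite ltrDl.
  move=> /rat_in_itvoo[r]; rewrite in_itv/= => /andP[r1 r2]; exists r.
  by rewrite distrC gtr0_norm ?subr_gt0// ltrBlDl.
exists [tuple r j | j < p] => //=; rewrite in_itv/= /G.
set q := [tuple r j | j < p].
set S := \sum_(j < p) _.
have S0 : 0 <= S by apply: sumr_ge0 => j _.
have SL : S <= p%:R * de.
  rewrite mulr_natl -[X in _ *+ X](card_ord p) -sumr_const.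
  by apply: ler_sum => j _; rewrite tnth_map tnth_mktuple ltW.
have := FL1 x (rt q); rewrite -/S ler_norml => /andP[h1 _].
have : L * S <= (L + 1) * S by rewrite ler_wpM2r// lerDl.
have : (L + 1) * S < (L + 1) * (p.+1%:R * de).
  rewrite ltr_pM2l//; apply: (le_lt_trans SL).
  by rewrite ltr_pM2r// ltr_nat.
have -> : (L + 1) * (p.+1%:R * de) = (c - F x) / 2.
  by rewrite /de; field; rewrite !gt_eqF//.
lra.
Qed.

End lipschitz_measurability.

(** * Exponential moments of Lipschitz functions *)

Section real_facts.
Context {R : realType}.

(* Used to let a parameter tend to 1. *)
Lemma le_of_scaled (a b : R) : 0 <= b ->
  (forall l, 0 < l -> l < 1 -> l * a <= b) -> a <= b.
Proof.
move=> b0 H; rewrite leNgt; apply/negP => ba.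
have a0 : 0 < a by exact: le_lt_trans ba.
pose l := (b / a + 1) / 2.
have ba1 : b / a < 1 by rewrite ltr_pdivrMr// mul1r.
have ba0 : 0 <= b / a by rewrite divr_ge0// ltW.
have := H l; rewrite /l; have -> : (b / a + 1) / 2 * a = (b + a) / 2.
  by field; rewrite gt_eqF.
have h1 : 0 < (b / a + 1) / 2 by lra.
have h2 : (b / a + 1) / 2 < 1 by lra.
move=> /(_ h1 h2); lra.
Qed.

Lemma sinh_ge (x : R) : 0 <= x -> 2 * x <= expR x - expR (- x).
Proof.
move=> x0.
pose f (y : R) := expR y - expR (- y) - 2 * y.
have df (y : R) : is_derive y 1 f (expR y + expR (- y) - 2).
  rewrite /f.
  apply: is_derive_eq.
  by rewrite /GRing.scale/=; ring.
have : f 0 <= f x.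
  apply: (@ger0_derive1_ndecry _ f 0) => //.
  - move=> y _.
    rewrite derive1E derive_val.
    have := expR_ge1Dx y; have := expR_ge1Dx (- y); lra.
  - apply: derivable_within_continuous => y _; exact: ex_derive.
rewrite /f oppr0 expR0 subrr mulr0 subrr; lra.
Qed.

Lemma cosh_ge (x : R) : 2 + x ^+ 2 <= expR x + expR (- x).
Proof.
wlog x0 : x / 0 <= x.
  move=> H; have [/H//|x0] := leP 0 x.
  have := H (- x); rewrite sqrrN opprK => {}H; rewrite (addrC (expR x)).
  by apply: H; rewrite oppr_ge0 ltW.
have h := sinh_ge (divr_ge0 x0 (ler0n _ 2)).
have : (2 * (x / 2)) ^+ 2 <= (expR (x / 2) - expR (- (x / 2))) ^+ 2.
  by rewrite lerXn2r// nnegrE ?(le_trans _ h)// mulr_ge0// divr_ge0.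
have e1 : expR (x / 2) ^+ 2 = expR x.
  by rewrite -expRM_natl; congr expR; field.
have e2 : expR (- (x / 2)) ^+ 2 = expR (- x).
  by rewrite -expRM_natl; congr expR; field.
have e3 : expR (x / 2) * expR (- (x / 2)) = 1 by rewrite -expRD subrr expR0.
have -> : (expR (x / 2) - expR (- (x / 2))) ^+ 2 = expR (x / 2) ^+ 2 +
   expR (- (x / 2)) ^+ 2 - 2 * (expR (x / 2) * expR (- (x / 2))) by ring.
have -> : (2 * (x / 2)) ^+ 2 = x ^+ 2 by field.
rewrite e1 e2 e3; lra.
Qed.

End real_facts.

Section gaussian_mgf.
Context {R : realType} {p : nat}.
Implicit Types F : p.-tuple R -> R.
Local Notation nu := (std_gaussian p).

(** The dual transport inequality for [f = F - L^2 / (2 l)] and [g = F]; the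
    hypothesis holds because [L e <= l e^2 / 2 + L^2 / (2 l)]. *)
Lemma mgf_bounded (L M : R) F : 0 <= L -> lipschitz_enorm L F ->
  (forall x, `|F x| <= M) ->
  \int[nu]_x expR (F x) <= expR (\int[nu]_x F x + L ^+ 2 / 2).
Proof.
move=> L0 FL FM; have mF := measurable_lipschitz L0 FL.
have Ei : nu.-integrable setT (EFin \o (fun x => expR (F x))).
  apply: (@integrable_bounded _ _ _ _ _ (expR M)); last exact: expR_bounded.
  exact: measurableT_comp.
set U := \int[nu]_x expR (F x); set G := \int[nu]_x F x.
have [U0|U0] := leP U 0; first by apply: (le_trans U0); rewrite expR_ge0.
rewrite -[leLHS]lnK ?posrE// ler_expR -lerBlDl.
apply: le_of_scaled => [|l l0 l1]; first by rewrite divr_ge0// sqr_ge0.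
pose c := L ^+ 2 / (2 * l).
have c0 : 0 <= c by rewrite divr_ge0 ?sqr_ge0// mulr_ge0// ltW.
have := dual_transport_gauss l0 l1 (f := fun x => F x - c) (g := F) (M := M + c).
have -> : \int[nu]_x expR (F x - c) = U * expR (- c).
  by under eq_Rintegral do rewrite expRD; rewrite RintegralZr.
move=> H; have {H} : U * expR (- c) <= expR G.
  apply: H => //.
  - exact: measurable_funB.
  - by move=> x; apply: (le_trans (ler_normB _ _)); rewrite (ger0_norm c0) lerD2r.
  - by move=> x; apply: (le_trans (FM x)); rewrite lerDl.
  move=> x y; set e := enorm _.
  have : F x - F y <= L * e by apply: le_trans (FL x y); exact: ler_norm.
  have : 0 <= (l * e - L) ^+ 2 / (2 * l).
    by rewrite divr_ge0 ?sqr_ge0// mulr_ge0// ltW.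
  have -> : (l * e - L) ^+ 2 / (2 * l) = l / 2 * e ^+ 2 - L * e + c.
    by rewrite /c; field; rewrite gt_eqF.
  lra.
rewrite -{1}(@lnK _ U) ?posrE// -expRD ler_expR => H.
have {}H : ln U - G <= c by lra.
have := ler_wpM2l (ltW l0) H.
by have -> : l * c = L ^+ 2 / 2 by rewrite /c; field; rewrite gt_eqF.
Qed.

End gaussian_mgf.

Section stationary_convergence.
Context {d} {T : measurableType d} {R : realType}.

(** Monotone convergence for a sequence that is stationary at every point. *)
Lemma ge0_integral_le_stationary (nu : {measure set T -> \bar R})
    (g : nat -> T -> R) (f : T -> R) (C : \bar R) :
  (forall n, measurable_fun setT (g n)) -> (forall n x, 0 <= g n x) ->
  (forall x m n, (m <= n)%N -> g m x <= g n x) ->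
  (forall x, exists n, forall m, (n <= m)%N -> g m x = f x) ->
  (forall n, (\int[nu]_x (g n x)%:E <= C)%E) -> (\int[nu]_x (f x)%:E <= C)%E.
Proof.
move=> mg g0 gnd gf gC.
have -> : (\int[nu]_x (f x)%:E = \int[nu]_x limn (fun n => (g n x)%:E))%E.
  apply: eq_integral => x _; apply/esym/cvg_lim => //.
  have [n nf] := gf x; apply: cvg_near_cst; near=> m; congr EFin; apply: nf.
  by near: m; exact: nbhs_infty_ge.
rewrite monotone_convergence//.
- apply: lime_le; last by near=> n; exact: gC.
  apply: ereal_nondecreasing_is_cvgn => m n mn.
  apply: ge0_le_integral => //=.
  + by move=> x _; rewrite lee_fin.
  + exact/measurable_EFinP.
  + exact/measurable_EFinP.
  + by move=> x _; rewrite lee_fin gnd.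
- by move=> n; exact/measurable_EFinP.
- by move=> n x _; rewrite lee_fin.
- by move=> x _ m n mn; rewrite lee_fin gnd.
Unshelve. all: by end_near. Qed.

Lemma Rintegral_expRN_gt0 (nu : probability T R) (f : T -> R) :
  measurable_fun setT f -> (forall x, 0 <= f x) ->
  0 < \int[nu]_x expR (- f x).
Proof.
move=> mf f0.
have me : measurable_fun setT (fun x => expR (- f x)).
  by apply: measurableT_comp => //; exact: measurableT_comp.
have ei : nu.-integrable setT (EFin \o (fun x => expR (- f x))).
  apply: (@integrable_bounded _ _ _ _ _ 1) => // x.
  by rewrite ger0_norm ?expR_ge0// -[leRHS]expR0 ler_expR oppr_le0.
rewrite lt_neqAle Rintegral_ge0 ?andbT; last by move=> x _; exact: expR_ge0.
apply/eqP => /esym K0.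
have : (\int[nu]_x `|(expR (- f x))%:E| = 0)%E.
  under eq_integral do rewrite gee0_abs ?lee_fin ?expR_ge0//.
  rewrite -[LHS]fineK; last exact: integrable_fin_num ei.
  by rewrite -[fine _]/(\int[nu]_x expR (- f x)) K0.
move=> /(ae_eq_integral_abs nu measurableT (f := fun x => (expR (- f x))%:E)).
have mEe : measurable_fun setT (fun x => (expR (- f x))%:E).
  exact/measurable_EFinP.
move=> /(_ mEe) [N [mN N0 NT]].
have : nu setT = 0%E.
  apply/eqP; rewrite eq_le measure_ge0 andbT -N0; apply: le_measure; rewrite ?inE//.
  move=> x _; apply: NT => /(_ I)/= [] /eqP.
  by rewrite gt_eqF// expR_gt0.
by rewrite probability_setT => /eqP; rewrite onee_eq0.
Qed.

End stationary_convergence.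

Section gaussian_mgf_unbounded.
Context {R : realType} {p : nat}.
Local Notation nu := (std_gaussian p).
Variables (L : R) (F : p.-tuple R -> R).
Hypotheses (L0 : 0 <= L) (FL : lipschitz_enorm L F) (F0 : forall x, 0 <= F x).

Let mF : measurable_fun setT F. Proof. exact: measurable_lipschitz FL. Qed.

(* The truncation of [F] at height [n]. *)
Let tr (n : nat) x := Num.min (F x) n%:R.

Let mtr n : measurable_fun setT (tr n). Proof. exact: measurable_minr. Qed.

Let tr_ge0 n x : 0 <= tr n x. Proof. by rewrite le_min F0 ler0n. Qed.

Let trM n x : `|tr n x| <= n%:R.
Proof. by rewrite ger0_norm// ge_min lexx orbT. Qed.

Let tr_le n x : tr n x <= F x. Proof. by rewrite ge_min lexx. Qed.

Let tr_nd x m n : (m <= n)%N -> tr m x <= tr n x.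
Proof.
by move=> mn; rewrite le_min tr_le/= ge_min ler_nat mn orbT.
Qed.

Let tr_stat x : exists n, forall m, (n <= m)%N -> tr m x = F x.
Proof.
exists (Num.truncn (F x)).+1 => m nm; apply/min_idPl.
by rewrite (le_trans (ltW (truncnS_gt _)))// ler_nat.
Qed.

Let trL n : lipschitz_enorm L (tr n).
Proof.
move=> x y; apply: le_trans (FL x y); rewrite /tr.
have := ler_norm (F x - F y); have := ler_norm (F y - F x).
rewrite distrC => h1 h2; rewrite ler_norml.
by rewrite !minEle; case: ifPn => hx; case: ifPn => hy;
  rewrite -?ltNge in hx hy *; lra.
Qed.

Let trNL n : lipschitz_enorm L (fun x => - tr n x).
Proof. by move=> x y; rewrite -opprD normrN; exact: trL. Qed.

Let kappa := \int[nu]_x expR (- F x).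

Let kappa0 : 0 < kappa. Proof. exact: Rintegral_expRN_gt0. Qed.

Let intexpN (f : p.-tuple R -> R) : measurable_fun setT f -> (forall x, 0 <= f x) ->
  nu.-integrable setT (EFin \o (fun x => expR (- f x))).
Proof.
move=> mf f0; apply: (@integrable_bounded _ _ _ _ _ 1).
  by apply: measurableT_comp => //; exact: measurableT_comp.
by move=> x; rewrite ger0_norm ?expR_ge0// -[leRHS]expR0 ler_expR oppr_le0.
Qed.

Let mean_tr n : \int[nu]_x tr n x <= L ^+ 2 / 2 - ln kappa.
Proof.
have := mgf_bounded L0 (trNL n) (M := n%:R).
have -> : \int[nu]_x - tr n x = - \int[nu]_x tr n x.
  under eq_Rintegral do rewrite -mulN1r.
  by rewrite RintegralZl ?mulN1r//; apply: integrable_bounded (trM n).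
move=> H; have : kappa <= expR (- (\int[nu]_x tr n x) + L ^+ 2 / 2).
  apply: le_trans (H _); last by move=> x; rewrite normrN.
  apply: le_Rintegral => //=; [exact: intexpN|exact: intexpN|].
  by move=> x _; rewrite ler_expR lerN2.
rewrite -{1}(@lnK _ kappa) ?posrE// ler_expR; lra.
Qed.

Let int_F_le : (\int[nu]_x (F x)%:E <= (L ^+ 2 / 2 - ln kappa)%:E)%E.
Proof.
apply: (ge0_integral_le_stationary mtr tr_ge0 tr_nd tr_stat) => n.
rewrite -(@fineK _ (\int[nu]_x (tr n x)%:E)%E) ?lee_fin; first exact: mean_tr.
apply: integrable_fin_num => //.
exact: integrable_bounded (trM n).
Qed.

(** A nonnegative Lipschitz function is integrable for the Gaussian measure: the
    integral of [exp (- F)] is positive and is at most the exponential moment of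
    minus a truncation of [F], which bounds the means of the truncations. *)
Lemma integrable_lipschitz : nu.-integrable setT (EFin \o F).
Proof.
apply/integrableP; split; first exact/measurable_EFinP.
under eq_integral do rewrite /= ger0_norm//.
by apply: le_lt_trans int_F_le _; rewrite ltry.
Qed.

Let m := \int[nu]_x F x.

Let mE : (\int[nu]_x (F x)%:E)%E = m%:E.
Proof. by rewrite /m /Rintegral fineK//;
  exact: integrable_fin_num integrable_lipschitz. Qed.

Lemma mgfN_lipschitz : \int[nu]_x expR (- F x) <= expR (- m + L ^+ 2 / 2).
Proof.
rewrite -/kappa -{1}(@lnK _ kappa) ?posrE// ler_expR.
have := int_F_le; rewrite mE lee_fin; lra.
Qed.

Let int_exp_le : (\int[nu]_x (expR (F x))%:E <= (expR (m + L ^+ 2 / 2))%:E)%E.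
Proof.
apply: (@ge0_integral_le_stationary _ _ _ _ (fun n x => expR (tr n x))).
- by move=> n; apply: measurableT_comp.
- by move=> n x; exact: expR_ge0.
- by move=> x a b ab; rewrite ler_expR tr_nd.
- by move=> x; have [n nP] := tr_stat x; exists n => k nk; rewrite nP.
move=> n; rewrite -(@fineK _ (\int[nu]_x (expR (tr n x))%:E)%E); last first.
  apply: integrable_fin_num => //.
  apply: (@integrable_bounded _ _ _ _ _ (expR n%:R)); last exact: expR_bounded.
  exact: measurableT_comp.
rewrite lee_fin; apply: (le_trans (mgf_bounded L0 (trL n) (trM n))).
rewrite ler_expR lerD2r; apply: le_Rintegral => //=.
- exact: integrable_bounded (trM n).
- exact: integrable_lipschitz.
Qed.

Lemma integrable_expR_lipschitz : nu.-integrable setT (EFin \o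
  (fun x => expR (F x))).
Proof.
apply/integrableP; split; first by apply/measurable_EFinP; exact: measurableT_comp.
under eq_integral do rewrite /= ger0_norm ?expR_ge0//.
by apply: le_lt_trans int_exp_le _; rewrite ltry.
Qed.

Lemma mgf_lipschitz : \int[nu]_x expR (F x) <= expR (m + L ^+ 2 / 2).
Proof.
rewrite -lee_fin; apply: le_trans int_exp_le; rewrite le_eqVlt; apply/orP; left.
by apply/eqP; rewrite /Rintegral fineK//;
  exact: integrable_fin_num integrable_expR_lipschitz.
Qed.

End gaussian_mgf_unbounded.

(** * Gaussian concentration and Poincare inequality *)

Section exponential_markov.
Context {d} {T : measurableType d} {R : realType} (nu : probability T R).

Lemma measurable_ge (X : T -> R) (s : R) : measurable_fun setT X ->
  measurable [set x | s <= X x].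
Proof.
move=> mX; rewrite (_ : [set x | _] = setT `&` X @^-1` `[s, +oo[).
  exact: mX.
by rewrite setTI; apply/seteqP; split => x /=; rewrite in_itv/= andbT.
Qed.

Lemma exponential_markov (X : T -> R) (s : R) : measurable_fun setT X ->
  nu.-integrable setT (EFin \o (fun x => expR (X x))) ->
  (nu [set x | (s <= X x)%R] <= (expR (- s) * \int[nu]_x expR (X x))%:E)%E.
Proof.
move=> mX iX; have mA := measurable_ge s mX.
rewrite -RintegralZl// /Rintegral fineK; last first.
  by apply: integrable_fin_num => //; exact: (integrableZl measurableT _ iX).
rewrite -[X in nu X]setTI setIC -integral_indic//.
apply: ge0_le_integral => //=.
- by apply/measurable_EFinP; exact: measurable_indic.
- apply/measurable_EFinP; apply: measurable_funM => //; exact: measurableT_comp.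
move=> x _; rewrite lee_fin indicE; case: (boolP (x \in _)) => [|_].
  by rewrite inE/= => sX; rewrite -expRD -[leLHS]expR0 ler_expR addrC subr_ge0.
by rewrite mulr_ge0// expR_ge0.
Qed.

End exponential_markov.

Section gaussian_concentration.
Context {R : realType} {p : nat}.
Local Notation nu := (std_gaussian p).
Variables (L : R) (F : p.-tuple R -> R).
Hypotheses (L0 : 0 < L) (FL : lipschitz_enorm L F) (F0 : forall x, 0 <= F x).

Let mF : measurable_fun setT F. Proof. exact: measurable_lipschitz (ltW L0) FL. Qed.

Let aFL (a : R) : 0 <= a -> lipschitz_enorm (a * L) (fun x => a * F x).
Proof.
by move=> a0 x y; rewrite -mulrBr normrM ger0_norm// -mulrA ler_wpM2l.
Qed.

Let aF0 (a : R) : 0 <= a -> forall x, 0 <= a * F x.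
Proof. by move=> a0 x; rewrite mulr_ge0. Qed.

Let aL0 (a : R) : 0 <= a -> 0 <= a * L.
Proof. by move=> a0; rewrite mulr_ge0// ltW. Qed.

Let m := \int[nu]_x F x.

Let Fi : nu.-integrable setT (EFin \o F).
Proof. exact: integrable_lipschitz (ltW L0) FL F0. Qed.

Let amE (a : R) : \int[nu]_x (a * F x) = a * m.
Proof. by rewrite RintegralZl. Qed.

Let mgf_pos (a : R) : 0 <= a ->
  \int[nu]_x expR (a * F x) <= expR (a * m + (a * L) ^+ 2 / 2).
Proof. by move=> a0; have := mgf_lipschitz (aL0 a0) (aFL a0) (aF0 a0);
  rewrite amE. Qed.

Let mgf_neg (a : R) : 0 <= a ->
  \int[nu]_x expR (- (a * F x)) <= expR (- (a * m) + (a * L) ^+ 2 / 2).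
Proof. by move=> a0; have := mgfN_lipschitz (aL0 a0) (aFL a0) (aF0 a0);
  rewrite amE. Qed.

Let ipos (a : R) : 0 <= a -> nu.-integrable setT (EFin \o
  (fun x => expR (a * F x))).
Proof. by move=> a0; exact: integrable_expR_lipschitz (aL0 a0) (aFL a0)
  (aF0 a0). Qed.

Let ineg (a : R) : 0 <= a -> nu.-integrable setT (EFin \o
  (fun x => expR (- (a * F x)))).
Proof.
move=> a0; apply: (@integrable_bounded _ _ _ _ _ 1).
  by apply: measurableT_comp => //; apply: measurableT_comp => //;
    exact: measurable_funM.
by move=> x; rewrite ger0_norm ?expR_ge0// -[leRHS]expR0 ler_expR oppr_le0 aF0.
Qed.

(* Chernoff's bound with the optimal parameter [t / L]. *)
Let upper_tail (t : R) : 0 < t ->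
  (nu [set x | (m + t * L <= F x)%R] <= (expR (- (t ^+ 2 / 2)))%:E)%E.
Proof.
move=> t0; pose a := t / L; have a0 : 0 < a by rewrite divr_gt0.
have := @exponential_markov _ _ _ nu (fun x => a * F x) (a * (m + t * L)).
rewrite (_ : [set x | _] = [set x | m + t * L <= F x]); last first.
  by apply/seteqP; split => x /=; rewrite ler_pM2l.
move=> H; apply: (le_trans (H _ _)); [exact: measurable_funM|exact: ipos (ltW a0)|].
rewrite lee_fin; apply: (le_trans (ler_wpM2l (expR_ge0 _) (mgf_pos (ltW a0)))).
rewrite -expRD ler_expR le_eqVlt; apply/orP; left; apply/eqP.
by rewrite /a; field; rewrite gt_eqF.
Qed.

Let lower_tail (t : R) : 0 < t ->
  (nu [set x | (F x <= m - t * L)%R] <= (expR (- (t ^+ 2 / 2)))%:E)%E.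
Proof.
move=> t0; pose a := t / L; have a0 : 0 < a by rewrite divr_gt0.
have := @exponential_markov _ _ _ nu (fun x => - (a * F x)) (- (a * (m - t * L))).
rewrite (_ : [set x | _] = [set x | F x <= m - t * L]); last first.
  by apply/seteqP; split => x /=; rewrite lerN2 ler_pM2l.
move=> H; apply: (le_trans (H _ _)); [|exact: ineg (ltW a0)|].
  by apply: measurableT_comp => //; exact: measurable_funM.
rewrite lee_fin; apply: (le_trans (ler_wpM2l (expR_ge0 _) (mgf_neg (ltW a0)))).
rewrite -expRD ler_expR le_eqVlt; apply/orP; left; apply/eqP.
by rewrite /a; field; rewrite gt_eqF.
Qed.

Let a2V_le (a : R) (x : p.-tuple R) :
  2 + a ^+ 2 * (F x - m) ^+ 2 <= expR (- (a * m)) * expR (a * F x)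
     + expR (a * m) * expR (- (a * F x)).
Proof.
have := cosh_ge (a * (F x - m)); rewrite -!expRD exprMn.
have -> : - (a * m) + a * F x = a * (F x - m) by ring.
by have -> : a * m + - (a * F x) = - (a * (F x - m)) by ring.
Qed.

Let rhs_integrable (a : R) : 0 <= a -> nu.-integrable setT (EFin \o (fun x =>
  expR (- (a * m)) * expR (a * F x) + expR (a * m) * expR (- (a * F x)))).
Proof.
move=> a0.
have i1 := integrableZl measurableT (expR (- (a * m))) (ipos a0).
have i2 := integrableZl measurableT (expR (a * m)) (ineg a0).
exact: (integrableD measurableT i1 i2).
Qed.

Let G2i : nu.-integrable setT (EFin \o (fun x => (F x - m) ^+ 2)).
Proof.
apply: (le_integrable measurableT _ _ (rhs_integrable ler01)) => //.
  by apply/measurable_EFinP; apply: measurable_funX; exact: measurable_funB.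
move=> x _ /=; rewrite lee_fin ger0_norm ?sqr_ge0//.
apply: le_trans (ler_norm _); have := a2V_le 1 x; rewrite expr1n; lra.
Qed.

Let ci (a : R) : nu.-integrable setT (EFin \o (fun=> a)).
Proof. exact: (@integrable_bounded _ _ _ _ _ `|a|). Qed.

(** The Poincare inequality for [F], read off from the exponential moments:
    [exp x + exp (- x) >= 2 + x^2] bounds the variance by a quantity that tends
    to [L^2] as the parameter of the exponential moment tends to 0. *)
Lemma variance_lipschitz : \int[nu]_x ((F x - m) ^+ 2) <= L ^+ 2.
Proof.
set V := \int[nu]_x ((F x - m) ^+ 2).
have V0 : 0 <= V by apply: Rintegral_ge0 => x _; exact: sqr_ge0.
apply: le_of_scaled => [|l l0 l1]; first exact: sqr_ge0.
pose s := 1 - l; have s0 : 0 < s by rewrite subr_gt0.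
(* The parameter for which the exponential moments are at most [exp s]. *)
pose a := Num.sqrt (2 * s) / L.
have a0 : 0 < a by rewrite divr_gt0// sqrtr_gt0 mulr_gt0.
have aL2 : (a * L) ^+ 2 / 2 = s.
  by rewrite /a divfK ?gt_eqF// sqr_sqrtr ?mulr_ge0 ?(ltW s0)//; field.
have H : 2 + a ^+ 2 * V <= expR s + expR s.
  have -> : 2 + a ^+ 2 * V = \int[nu]_x (2 + a ^+ 2 * (F x - m) ^+ 2).
    rewrite RintegralD//=; last exact: (integrableZl measurableT (a ^+ 2) G2i).
    by rewrite Rintegral_cst//= probability_setT/= mulr1 RintegralZl.
  apply: (@le_trans _ _ (\int[nu]_x (expR (- (a * m)) * expR (a * F x)
     + expR (a * m) * expR (- (a * F x))))).
    apply: le_Rintegral => //=.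
    - exact: (integrableD measurableT (ci 2) (integrableZl measurableT (a ^+ 2)
      G2i)).
    - exact: rhs_integrable (ltW a0).
  have i1 := integrableZl measurableT (expR (- (a * m))) (ipos (ltW a0)).
  have i2 := integrableZl measurableT (expR (a * m)) (ineg (ltW a0)).
  rewrite (RintegralD measurableT i1 i2).
  rewrite (RintegralZl _ measurableT (ipos (ltW a0))).
  rewrite (RintegralZl _ measurableT (ineg (ltW a0))); apply: lerD.
    apply: (le_trans (ler_wpM2l (expR_ge0 _) (mgf_pos (ltW a0)))).
    by rewrite -expRD aL2 addKr.
  apply: (le_trans (ler_wpM2l (expR_ge0 _) (mgf_neg (ltW a0)))).
  by rewrite -expRD aL2 addNKr.
have Hs : l * expR s <= 1.
  have : expR s * (1 - s) <= expR s * expR (- s).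
    by rewrite ler_wpM2l ?expR_ge0// expR_ge1Dx.
  have -> : 1 - s = l by rewrite /s; ring.
  by rewrite -expRD subrr expR0 mulrC.
have : l * (2 + a ^+ 2 * V) <= 2.
  apply: (le_trans (ler_wpM2l (ltW l0) H)); rewrite mulrDr.
  by apply: (le_trans (lerD Hs Hs)); rewrite -[2]/(1 + 1 : R).
have : 2 * s = a ^+ 2 * L ^+ 2 by rewrite -aL2 exprMn; field.
move=> e1 e2; rewrite -(@ler_pM2l _ (a ^+ 2)) ?exprn_gt0// -e1.
have : l = 1 - s by rewrite /s; ring.
move: e2; rewrite mulrDr => e2 e3.
have -> : a ^+ 2 * (l * V) = l * (a ^+ 2 * V) by ring.
lra.
Qed.

Let F2E : \int[nu]_x (F x ^+ 2) = \int[nu]_x ((F x - m) ^+ 2) + m ^+ 2.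
Proof.
transitivity (\int[nu]_x ((F x - m) ^+ 2 + (2 * m * F x + - m ^+ 2))).
  by apply: eq_Rintegral => x _; ring.
have i2 := integrableZl measurableT (2 * m) Fi.
have i3 := integrableD measurableT i2 (ci (- m ^+ 2)).
rewrite (RintegralD measurableT G2i i3) (RintegralD measurableT i2 (ci _)).
rewrite RintegralZl// Rintegral_cst//= probability_setT/= -/m; ring.
Qed.

(** Concentration around the root mean square instead of the mean: by the Poincare
    inequality the two differ by at most [L]. *)
Lemma gaussian_rms_concentration (t : R) : 0 < t ->
  (nu [set x | (L * (t + 1) < `|F x - Num.sqrt (\int[nu]_x (F x ^+ 2))|)%R]
   <= (2 * expR (- (t ^+ 2 / 2)))%:E)%E.
Proof.
move=> t0; set r := Num.sqrt _.
have m0 : 0 <= m by apply: Rintegral_ge0.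
have V0 : 0 <= \int[nu]_x ((F x - m) ^+ 2).
  by apply: Rintegral_ge0 => x _; exact: sqr_ge0.
have VL := variance_lipschitz.
have mr : m <= r.
  by rewrite -[leLHS](ger0_norm m0) -sqrtr_sqr ler_wsqrtr// F2E lerDr.
have rm : r <= m + L.
  have mL : 0 <= m + L by rewrite addr_ge0// ltW.
  rewrite -[leRHS](ger0_norm mL) -sqrtr_sqr ler_wsqrtr// F2E sqrrD.
  have : 0 <= m * L *+ 2 by rewrite mulrn_wge0// mulr_ge0// ltW.
  lra.
have mU := measurable_ge (m + t * L) mF.
have mD : measurable [set x | F x <= m - t * L].
  have mNF : measurable_fun setT (fun x => - F x) by exact: measurableT_comp.
  have := measurable_ge (- (m - t * L)) mNF.
  by under eq_set do rewrite lerN2.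
apply: (@le_trans _ _ (nu ([set x | m +
  t * L <= F x] `|` [set x | F x <= m - t * L]))).
  apply: le_measure; rewrite ?inE//; last 2 first.
  - exact: measurableU.
  - move=> x /=; rewrite mulrDr mulr1 lter_normr => /orP[h|h]; [left|right]; lra.
  have mFr : measurable_fun setT (fun x => `|F x - r|).
    by apply: measurableT_comp => //; exact: measurable_funB.
  rewrite (_ : [set x | _] = setT `&` (fun x => `|F x - r|) @^-1` `]L * (t +
    1), +oo[).
    exact: mFr.
  by rewrite setTI; apply/seteqP; split => x /=; rewrite in_itv/= andbT.
apply: (le_trans (measureU2 _ mU mD)).
by rewrite mulr_natl mulr2n EFinD; apply: leeD;
  [exact: upper_tail|exact: lower_tail].
Qed.

End gaussian_concentration.

(** * Rotation invariance of the Gaussian measure *)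

Section gaussian_rotation_1d.
Context {R : realType}.
Local Notation mu := (@lebesgue_measure R).
Local Notation MR := (measurableTypeR R).
Local Notation gauss := (normal_prob (0 : R) 1).
Local Notation phi := (normal_pdf (0 : R) 1).

Let phi_ge0 (x : R) : 0 <= phi x. Proof. exact: normal_pdf_ge0. Qed.

Let mphi : measurable_fun [set: MR] (phi : MR -> R).
Proof. exact: measurable_normal_pdf. Qed.

Lemma measurable_lin2 (a b : R) :
  measurable_fun [set: MR * MR] (fun z : MR * MR => a * z.1 + b * z.2 : MR).
Proof.
have h1 : measurable_fun [set: MR * MR] (fun z : MR * MR => z.1 : R) :=
  measurable_fst.
have h2 : measurable_fun [set: MR * MR] (fun z : MR * MR => z.2 : R) :=
  measurable_snd.
have : measurable_fun [set: MR * MR] (fun z : MR * MR => a * z.1 + b * z.2).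
  by apply: measurable_funD; exact: measurable_funM.
exact.
Qed.

(* Completion of the square in [y]. *)
Let phi_mul (a b c u y : R) : a != 0 -> c != 0 -> c ^+ 2 = a ^+ 2 + b ^+ 2 ->
  phi ((u - b * y) / a) * phi y =
  phi (c^-1 * u + 0) * phi (c / a * y + - (b * u / (c * a))).
Proof.
move=> a0 c0 c2; rewrite !normal_pdf01E mulrACA [RHS]mulrACA; congr (_ * _).
rewrite -!expRD; congr expR.
have E : c ^+ 2 != 0 by rewrite expf_neq0.
apply: (mulIf (mulf_neq0 (expf_neq0 2 a0) E)).
transitivity (- ((u ^+ 2 - 2 * b * u * y + (a ^+ 2 + b ^+ 2) * y ^+ 2)
  * c ^+ 2 / 2)).
  by field.
rewrite -c2.
transitivity (- ((u ^+ 2 * (c ^+ 2 - b ^+ 2) + (c ^+ 2 * y - b * u) ^+ 2) / 2)).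
  by field.
have -> : c ^+ 2 - b ^+ 2 = a ^+ 2 by rewrite c2; ring.
by field; rewrite c0 a0.
Qed.

Let integral_phi : (\int[mu]_x (phi x)%:E = 1)%E.
Proof. exact: integral_normal_pdf. Qed.

Let integral_phi_mul (a b c u : R) : a != 0 -> 0 < c -> c ^+ 2 = a ^+ 2 + b ^+ 2 ->
  (\int[mu]_y (phi ((u - b * y) / a) * phi y)%:E = (phi (c^-1 * u + 0)
    * (`|a| / c))%:E)%E.
Proof.
move=> a0 c0 c2; have cn0 : c != 0 by rewrite gt_eqF.
under eq_integral do rewrite (phi_mul u _ a0 cn0 c2) EFinM.
rewrite ge0_integralZl//=; last 3 first.
- apply/measurable_EFinP;
  apply: (@measurableT_comp _ _ _ _ _ _ (phi : MR -> R)) => //.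
  exact: measurable_affine.
- by move=> y _; rewrite lee_fin.
- by rewrite lee_fin.
rewrite EFinM; congr (_ * _)%E.
have ca : c / a != 0 by rewrite mulf_neq0// invr_neq0.
have := @ge0_integral_affine R (c / a) (- (b * u / (c * a)))
  (fun x => (phi x)%:E) ca.
rewrite integral_phi => H.
have {}H : (1 = `|c / a|%:E * \int[mu]_y (phi (c / a * y +
  - (b * u / (c * a))))%:E)%E.
  apply: H; last by move=> x; rewrite lee_fin.
  by apply/measurable_EFinP; exact: measurable_normal_pdf.
have -> : (`|a| / c)%:E = ((`|c / a|^-1)%R%:E * 1)%E.
  by rewrite mule1 normrM normfV (gtr0_norm c0) invfM invrK mulrC.
by rewrite H muleA -EFinM mulVf ?normr_eq0// mul1e.
Qed.

Let rotation1_neq0 (a b : R) (G : MR -> \bar R) : a != 0 ->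
  measurable_fun setT G -> (forall x, 0 <= G x)%E ->
  (\int[gauss]_y \int[gauss]_x G (a * x + b * y)%R =
   \int[gauss]_z G (Num.sqrt (a ^+ 2 + b ^+ 2) * z)%R)%E.
Proof.
move=> a0 mG G0; set c := Num.sqrt _.
have ab0 : 0 < a ^+ 2 + b ^+ 2 by rewrite ltr_pwDl ?sqr_ge0// exprn_even_gt0.
have c0 : 0 < c by rewrite sqrtr_gt0.
have cn0 : c != 0 by rewrite gt_eqF.
have c2 : c ^+ 2 = a ^+ 2 + b ^+ 2 by rewrite sqr_sqrtr// ltW.
have mGl : measurable_fun setT (fun z : MR * MR => G (a * z.1 + b * z.2)%R).
  by apply: (@measurableT_comp _ _ _ _ _ _ G) => //; exact: measurable_lin2.
have mGs (y : R) : measurable_fun setT (fun x : MR => G (a * x + b * y)%R).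
  by apply: (@measurableT_comp _ _ _ _ _ _ G) => //; exact: measurable_affine.
have mpa (y : R) : measurable_fun setT (fun u : MR => phi ((u - b * y) / a)).
  apply: (@measurableT_comp _ _ _ _ _ _ (phi : MR -> R)) => //.
  have := measurable_affine a^-1 (- (a^-1 * (b * y))).
  by congr measurable_fun; apply/funext => u; field.
(* substitution u = a x + b y in the inner integral *)
have inner (y : R) : (\int[gauss]_x G (a * x + b * y)%R =
    \int[mu]_u ((`|a|^-1)%R%:E * (G u * (phi ((u - b * y) / a))%:E)))%E.
  rewrite ge0_integral_normal//.
  have mGp : measurable_fun setT (fun u : MR => G u * (phi ((u - b * y) / a))%:E)%E.
    by apply: emeasurable_funM => //; exact/measurable_EFinP.
  have Gp0 u : (0 <= G u * (phi ((u - b * y)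
    / a))%:E)%E by rewrite mule_ge0// lee_fin.
  rewrite ge0_integralZl//.
  rewrite [X in _ = (_ * X)%E](ge0_integral_affine (b * y)
    a0)// muleA -EFinM mulVf ?normr_eq0// mul1e.
  by apply: eq_integral => x _; rewrite addrK mulrAC divff// mul1r.
pose K (z : MR * MR) : \bar R :=
  ((`|a|^-1)%R%:E * (G z.2 * (phi ((z.2 - b * z.1) / a))%:E) * (phi z.1)%:E)%E.
have mK : measurable_fun setT K.
  apply: emeasurable_funM; last first.
    apply/measurable_EFinP;
      apply: (@measurableT_comp _ _ _ _ _ _ (phi : MR -> R)) => //.
  apply: emeasurable_funM => //; apply: emeasurable_funM.
    exact: (@measurableT_comp _ _ _ _ _ _ G).
  apply/measurable_EFinP;
    apply: (@measurableT_comp _ _ _ _ _ _ (phi : MR -> R)) => //.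
  have := measurable_lin2 (- (a^-1 * b)) a^-1.
  by congr measurable_fun; apply/funext => -[y u]/=; field.
have K0 z : (0 <= K z)%E by rewrite /K !mule_ge0// lee_fin// invr_ge0.
transitivity (\int[mu]_y \int[mu]_u K (y, u))%E.
  rewrite ge0_integral_normal; last 2 first.
  - exact: (@measurable_fun_fubini_tonelli_G _ _ _ _ _ gauss
    (fun z => G (a * z.1 + b * z.2)%R)).
  - by move=> y; exact: integral_ge0.
  apply: eq_integral => y _; rewrite inner -ge0_integralZr//.
  - apply: emeasurable_funM => //; apply: emeasurable_funM => //.
    exact/measurable_EFinP.
  - by move=> u _; rewrite !mule_ge0// lee_fin// invr_ge0.
  - by rewrite lee_fin.
(* After exchanging the integrals, [y] is integrated out. *)
rewrite (fubini_tonelli K)//.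
transitivity (\int[mu]_u ((c^-1)%R%:E * (G u * (phi (c^-1 * u + 0))%:E)))%E.
  apply: eq_integral => u _; rewrite /K/=.
  under eq_integral do rewrite -!muleA -EFinM.
  have mpp : measurable_fun setT (fun y : MR => (phi ((u - b * y) / a) * phi y)%:E).
    apply/measurable_EFinP; apply: measurable_funM => //.
    apply: (@measurableT_comp _ _ _ _ _ _ (phi : MR -> R)) => //.
    have := measurable_affine (- (a^-1 * b)) (a^-1 * u).
    by congr measurable_fun; apply/funext => y; field.
  have pp0 (y : R) : (0 <= (phi ((u - b * y) / a) * phi y)%:E)%E.
    by rewrite lee_fin mulr_ge0.
  have Gpp0 (y : R) : (0 <= G u * (phi ((u - b * y) / a) * phi y)%:E)%E.
    by rewrite mule_ge0.
  have mGpp : measurable_fun setT (fun y : MR => G u * (phi ((u - b * y) / a)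
    * phi y)%:E)%E.
    exact: emeasurable_funM.
  rewrite ge0_integralZl// ge0_integralZl//.
  rewrite (integral_phi_mul u a0 c0 c2) muleCA [RHS]muleCA; congr (_ * _)%E.
  rewrite -!EFinM; congr EFin; field.
  by rewrite cn0 normr_eq0.
have mpc : measurable_fun setT (fun u : MR => phi (c^-1 * u + 0)).
  apply: (@measurableT_comp _ _ _ _ _ _ (phi : MR -> R)) => //.
  exact: measurable_affine.
rewrite ge0_integralZl//; last 3 first.
- by apply: emeasurable_funM => //; exact/measurable_EFinP.
- by move=> u _; rewrite mule_ge0// lee_fin.
- by rewrite lee_fin invr_ge0 ltW.
rewrite (@ge0_integral_affine R c 0)//; last 2 first.
- by apply: emeasurable_funM => //; exact/measurable_EFinP.
- by move=> u; rewrite mule_ge0// lee_fin.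
have mGc : measurable_fun setT (fun z : MR => G (c * z)%R).
  have := measurable_affine c 0;
    rewrite (_ : (fun x : R => c * x + 0) = (fun x => c * x)).
    by move=> h; exact: (@measurableT_comp _ _ _ _ _ _ G).
  by apply/funext => x; rewrite addr0.
rewrite (ge0_integral_normal mGc (fun z => G0 _)) (gtr0_norm c0) muleA -EFinM.
rewrite mulVf// mul1e; apply: eq_integral => z _.
by rewrite !addr0 mulKf.
Qed.

(** Rotation invariance in dimension one: [a x + b y] is distributed as
    [sqrt (a^2 + b^2) z]. *)
Lemma gaussian_rotation1 (a b : R) (G : MR -> \bar R) :
  measurable_fun setT G -> (forall x, 0 <= G x)%E ->
  (\int[gauss]_x \int[gauss]_y G (a * x + b * y)%R =
   \int[gauss]_z G (Num.sqrt (a ^+ 2 + b ^+ 2) * z)%R)%E.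
Proof.
move=> mG G0.
have [b0|b0] := eqVneq b 0; last first.
  rewrite (addrC (a ^+ 2)) -(rotation1_neq0 a b0 mG G0).
  by apply: eq_integral => x _; apply: eq_integral => y _; rewrite addrC.
have [a0|a0] := eqVneq a 0.
  rewrite a0 b0 expr0n addr0 sqrtr0.
  under eq_integral do under eq_integral do rewrite !mul0r addr0.
  under [RHS]eq_integral do rewrite mul0r.
  have cst1 (r : \bar R) : (\int[gauss]_x r = r)%E.
    by rewrite integral_cst// [X in (_ * X)%E](_ : _ = 1%E) ?mule1.
  by under eq_integral do rewrite cst1; rewrite !cst1.
rewrite -(rotation1_neq0 b a0 mG G0) -(fubini_tonelli (fun z :
  MR * MR => G (a * z.1 + b * z.2)%R))//.
by apply: (@measurableT_comp _ _ _ _ _ _ G) => //; exact: measurable_lin2.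
Qed.

End gaussian_rotation_1d.

Section gaussian_rotation.
Context {R : realType}.
Local Notation MR := (measurableTypeR R).
Local Notation gauss := (normal_prob (0 : R) 1).

(** Multiples and linear combinations of vectors stored as tuples. *)
Definition tscale {p : nat} (c : R) (z : p.-tuple R) : p.-tuple R :=
  [tuple c * tnth z j | j < p].

Definition tcomb {p : nat} (a b : R) (x y : p.-tuple R) : p.-tuple R :=
  [tuple a * tnth x j + b * tnth y j | j < p].

Lemma tscale_tcons (p : nat) (c u : R) (z : p.-tuple R) :
  tscale c (tcons (u : MR, z)) = tcons (c * u : MR, tscale c z).
Proof.
apply: eq_from_tnth => j; rewrite tnth_mktuple.
by case: (unliftP ord0 j) => [k|] ->; rewrite ?tnthS ?tnth_mktuple.
Qed.

Lemma tcomb_tcons (p : nat) (a b u v : R) (x y : p.-tuple R) :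
  tcomb a b (tcons (u : MR, x)) (tcons (v : MR, y)) =
  tcons (a * u + b * v : MR, tcomb a b x y).
Proof.
apply: eq_from_tnth => j; rewrite tnth_mktuple.
by case: (unliftP ord0 j) => [k|] ->; rewrite ?tnthS ?tnth_mktuple.
Qed.

Lemma measurable_tscale (p : nat) (c : R) : measurable_fun setT (@tscale p c).
Proof.
apply/measurable_fun_tnthP => j /=.
rewrite (_ : _ \o _ = fun z : p.-tuple R => c * tnth z j).
  by apply: measurable_funM => //; exact: measurable_tnth.
by apply/funext => z; rewrite /= tnth_mktuple.
Qed.

Lemma measurable_funscale {d} {T : measurableType d} (p : nat)
    (c : T -> R) (z : T -> p.-tuple R) :
  measurable_fun setT c -> measurable_fun setT z ->
  measurable_fun setT (fun t => tscale (c t) (z t)).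
Proof.
move=> mc mz; apply/measurable_fun_tnthP => j /=.
rewrite (_ : _ \o _ = fun t => c t * tnth (z t) j).
  apply: measurable_funM => //.
  by apply: (@measurableT_comp _ _ _ _ _ _ (fun z : p.-tuple R => tnth z j))
    => //; exact: measurable_tnth.
by apply/funext => t; rewrite /= tnth_mktuple.
Qed.

Lemma measurable_funcomb {d} {T : measurableType d} (p : nat) (a b : R)
    (x y : T -> p.-tuple R) :
  measurable_fun setT x -> measurable_fun setT y ->
  measurable_fun setT (fun t => tcomb a b (x t) (y t)).
Proof.
move=> mx my; apply/measurable_fun_tnthP => j /=.
rewrite (_ : _ \o _ = fun t => a * tnth (x t) j + b * tnth (y t) j).
  apply: measurable_funD; apply: measurable_funM => //.
    by apply: (@measurableT_comp _ _ _ _ _ _ (fun z : p.-tuple R => tnth z j))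
      => //; exact: measurable_tnth.
  by apply: (@measurableT_comp _ _ _ _ _ _ (fun z : p.-tuple R => tnth z j))
    => //; exact: measurable_tnth.
by apply/funext => t; rewrite /= tnth_mktuple.
Qed.

Lemma measurable_funtcons {d} {T : measurableType d} (p : nat)
    (u : T -> MR) (z : T -> p.-tuple R) :
  measurable_fun setT u -> measurable_fun setT z ->
  measurable_fun setT (fun t => tcons (u t, z t)).
Proof.
move=> mu mz; apply: (@measurableT_comp _ _ _ _ _ _ (@tcons R p)) => //.
exact/measurable_fun_pairP.
Qed.

Lemma ge0_integral_gaussS (p : nat) (G : p.+1.-tuple R -> \bar R) :
  measurable_fun setT G -> (forall x, 0 <= G x)%E ->
  (\int[std_gaussian p.+1]_x G x =
   \int[gauss]_u \int[std_gaussian p]_z G (tcons (u, z)))%E.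
Proof.
move=> mG G0; rewrite /= ge0_integral_distribution// fubini_tonelli1//.
  exact: measurableT_comp.
by move=> x; exact: G0.

Qed.

(** Rotation invariance in dimension [p], by the one-dimensional case in the first
    coordinate and induction in the others. *)
Lemma gaussian_rotation (p : nat) (a b : R) (G : p.-tuple R -> \bar R) :
  measurable_fun setT G -> (forall x, 0 <= G x)%E ->
  (\int[std_gaussian p]_x \int[std_gaussian p]_y G (tcomb a b x y) =
   \int[std_gaussian p]_z G (tscale (Num.sqrt (a ^+ 2 + b ^+ 2)) z))%E.
Proof.
set c := Num.sqrt _.
elim: p G => [|p IH] G mG G0.
  have GE x : G x = G [tuple] by congr (G _); exact: tuple0.
  under eq_integral do under eq_integral do rewrite GE.
  under [RHS]eq_integral do rewrite GE.
  by rewrite /= !integral_dirac// !diracE !mem_set// !mul1e.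
have mGc : measurable_fun setT (fun z :
  p.+1.-tuple R * p.+1.-tuple R => G (tcomb a b z.1 z.2)).
  by apply: measurableT_comp => //; exact: measurable_funcomb.
rewrite ge0_integral_gaussS; last 2 first.
- exact: (measurable_fun_fubini_tonelli_F _ mGc).
- by move=> x; apply: integral_ge0 => y _; exact: G0.
have mGs (c' : R) : measurable_fun setT (fun z : p.+1.-tuple R => G (tscale c' z)).
  by apply: measurableT_comp => //; exact: measurable_tscale.
rewrite ge0_integral_gaussS//.
pose K (u : MR) : \bar R := (\int[std_gaussian p]_z G (tcons (u, tscale c z)))%E.
have mK : measurable_fun setT K.
  apply: (@measurable_fun_fubini_tonelli_F _ _ _ _ _ (std_gaussian p)
    (fun uz : MR * p.-tuple R => G (tcons (uz.1, tscale c uz.2)))) => //.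
  apply: measurableT_comp => //; apply: measurable_funtcons => //.
  by apply: measurableT_comp => //; exact: measurable_tscale.
have K0 u : (0 <= K u)%E by apply: integral_ge0 => z _; exact: G0.
transitivity (\int[gauss]_z K (c * z)%R)%E; last first.
  by apply: eq_integral => u _; apply: eq_integral => z _; rewrite tscale_tcons.
rewrite -gaussian_rotation1//; apply: eq_integral => u _.
pose H (z : p.-tuple R * MR) : \bar R :=
  (\int[std_gaussian p]_y' G (tcons ((a * u + b * z.2)%R, tcomb a b z.1 y')))%E.
have mH : measurable_fun setT H.
  apply: (@measurable_fun_fubini_tonelli_F _ _ _ _ _ (std_gaussian p)
    (fun w : (p.-tuple R * MR) * p.-tuple R =>
      G (tcons ((a * u + b * w.1.2)%R, tcomb a b w.1.1 w.2)))) => //.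
  apply: measurableT_comp => //; apply: measurable_funtcons.
    have := measurable_affine b (a * u).
    rewrite (_ : (fun x : R => b * x + a * u) = (fun x => a * u + b * x));
      last first.
      by apply/funext => x; rewrite addrC.
    move=> h; apply: (@measurableT_comp _ _ _ _ _ _ (fun x : MR => a * u +
      b * x : MR)) => //.
    exact: measurableT_comp.
  by apply: measurable_funcomb => //; exact: measurableT_comp.
transitivity (\int[std_gaussian p]_x' \int[gauss]_v H (x', v))%E.
  apply: eq_integral => x' _; rewrite ge0_integral_gaussS//.
    apply: eq_integral => v _; apply: eq_integral => y' _.
    by rewrite tcomb_tcons.
  by apply: measurableT_comp => //; exact: measurable_funcomb.
have H0 z : (0 <= H z)%E by apply: integral_ge0 => y' _; exact: G0.
rewrite (fubini_tonelli H mH H0).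
apply: eq_integral => v _; rewrite /H/= /K.
apply: (IH (fun z => G (tcons ((a * u + b * v)%R, z)))) => //.
by apply: measurableT_comp => //; exact: measurable_funtcons.
Qed.

End gaussian_rotation.

(** * Independent copies and weighted sums *)

Section iid.
Context {d} {T : measurableType d} {R : realType}.

(** The isomorphism of [T * T ^ n] with [T ^ (n + 1)]. *)
Definition cons_tuple_pair {n : nat} (xy : T * n.-tuple T) : n.+1.-tuple T :=
  [the n.+1.-tuple T of xy.1 :: xy.2].

Lemma measurable_cons_tuple_pair (n : nat) :
  measurable_fun setT (@cons_tuple_pair n).
Proof. exact: (@measurable_cons _ _ (T * n.-tuple T)%type T fst n snd). Qed.

HB.instance Definition _ (n : nat) :=
  isMeasurableFun.Build _ _ _ _ (@cons_tuple_pair n)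
    (@measurable_cons_tuple_pair n).

(** The law of [n] independent variables of law [mu]. *)
Fixpoint iid (mu : probability T R) (n : nat) : probability (n.-tuple T) R :=
  match n with
  | 0 => dirac [tuple]
  | q.+1 => distribution (mu \x iid mu q)%E (@cons_tuple_pair q)
  end.

(** The product of the sets [A j]. *)
Definition tuple_box {n : nat} (A : 'I_n -> set T) : set (n.-tuple T) :=
  [set x | forall j, A j (tnth x j)].

Lemma measurable_tuple_box (n : nat) (A : 'I_n -> set T) :
  (forall j, measurable (A j)) -> measurable (tuple_box A).
Proof.
move=> mA; rewrite (_ : tuple_box A = \bigcap_(j in [set: 'I_n])
    ((fun x : n.-tuple T => tnth x j) @^-1` A j)).
  apply: fin_bigcap_measurable => // j _.
  by rewrite -[X in measurable X]setTI; apply: measurable_tnth.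
by apply/seteqP; split => x /= xA j; [move=> _; exact: xA|exact: xA].
Qed.

Lemma iid_box (mu : probability T R) (n : nat) (A : 'I_n -> set T) :
  (forall j, measurable (A j)) ->
  iid mu n (tuple_box A) = (\prod_(j < n) mu (A j))%E.
Proof.
elim: n A => [|n IH] A mA /=.
  by rewrite big_ord0 diracE mem_set//= => -[].
rewrite big_ord_recl /= /distribution /pushforward /= -IH//.
rewrite -product_measure1E//; last exact: measurable_tuple_box.
congr (_ _); apply/seteqP; split => -[a x] /=.
  move=> H; split; first by have := H ord0.
  by move=> j; have := H (lift ord0 j); rewrite tnthS.
move=> [Aa Ax] j; case: (unliftP ord0 j) => [k|] ->.
  by rewrite tnthS; exact: Ax.
by [].
Qed.

(** Probability measures on [n.-tuple T] are determined by boxes. *)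
Lemma tuple_probability_unique (n : nat) (P Q : probability (n.-tuple T) R) :
  (forall A : 'I_n -> set T, (forall j, measurable (A j)) ->
    P (tuple_box A) = Q (tuple_box A)) ->
  forall B, measurable B -> P B = Q B.
Proof.
move=> PQ.
pose G : set (set (n.-tuple T)) :=
  [set tuple_box A | A in [set A : 'I_n -> set T | forall j, measurable (A j)]].
have GT : G setT.
  exists (fun=> setT); first by move=> j; exact: measurableT.
  by apply/seteqP; split.
apply: (@measure_unique _ R (n.-tuple T) G (fun=> setT)) => //.
- apply/seteqP; split.
    apply: smallest_sub; first exact: smallest_sigma_algebra.
    apply: subset_trans (@sub_sigma_algebra _ _ _).
    rewrite -bigcup_seq => B [i _ [A mA <-]]; rewrite setTI.
    exists (fun j => if j == i then A else setT).
      by move=> j /=; case: ifP.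
    apply/seteqP; split => x /=; first by move=> /(_ i); rewrite eqxx.
    by move=> Ax j; case: eqP => [->|].
  apply: smallest_sub; first exact: sigma_algebra_measurable.
  by move=> _ [A mA <-]; exact: measurable_tuple_box.
- move=> _ _ [A mA <-] [B mB <-]; exists (fun j => A j `&` B j).
    by move=> j; exact: measurableI.
  apply/seteqP; split => x /=; first by move=> H; split=> j; case: (H j).
  by move=> [HA HB] j; split.
- by rewrite bigcup_const//; exists 0%N.
- by move=> _ [A mA <-]; exact: PQ.
- by move=> _; apply: le_lt_trans (probability_le1 P measurableT) _; rewrite ltry.
Qed.

Lemma ge0_integral_iidS (mu : probability T R) (n : nat) (G : n.+1.-tuple T ->
  \bar R) :
  measurable_fun setT G -> (forall x, 0 <= G x)%E ->
  (\int[iid mu n.+1]_x G x =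
   \int[mu]_u \int[iid mu n]_z G (cons_tuple_pair (u, z)))%E.
Proof.
move=> mG G0; rewrite /= ge0_integral_distribution// fubini_tonelli1//.
  exact: measurableT_comp.
by move=> x; exact: G0.
Qed.

End iid.

Section independent_copies.
Context {d d'} {Omega : measurableType d} {T : measurableType d'} {R : realType}.
Variables (P : probability Omega R) (n : nat) (X : 'I_n -> {RV P >-> T}).

(** The random tuple formed by the family [X]. *)
Definition tuple_RV (w : Omega) : n.-tuple T := [tuple X i w | i < n].

Lemma measurable_tuple_RV : measurable_fun setT tuple_RV.
Proof.
apply/measurable_fun_tnthP => i.
rewrite (_ : _ \o _ = X i); first exact: measurable_funP.
by apply/funext => w; rewrite /= tnth_mktuple.
Qed.

HB.instance Definition _ := isMeasurableFun.Build _ _ _ _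
  tuple_RV measurable_tuple_RV.

Lemma law_tuple_iid (mu : probability T R) :
  (forall i, has_law (X i) mu) -> mutually_independent P X ->
  forall B, measurable B ->
  P (tuple_RV @^-1` B) = iid mu n B.
Proof.
move=> Xmu Xind.
apply: (tuple_probability_unique
  (P := distribution P tuple_RV)) => A mA.
rewrite iid_box// /distribution /pushforward/=.
transitivity (P [set w | forall i, A i (X i w)]).
  congr (P _); apply/seteqP; split => w /= H j; have := H j;
    by rewrite tnth_mktuple.
by rewrite Xind//; apply: eq_bigr => i _; exact: Xmu.
Qed.

End independent_copies.

Section weighted_sum.
Context {R : realType} {p : nat}.
Local Notation nu := (std_gaussian p).

(** The sum of the vectors [x_i] with weights [a_i]. *)
Definition tsum {n : nat} (a : 'I_n -> R) (x : n.-tuple (p.-tuple R)) :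
  p.-tuple R :=
  [tuple \sum_(i < n) a i * tnth (tnth x i) j | j < p].

Lemma measurable_funtsum {d} {T : measurableType d} (n : nat) (a : 'I_n -> T -> R)
    (x : T -> n.-tuple (p.-tuple R)) :
  (forall i, measurable_fun setT (a i)) -> measurable_fun setT x ->
  measurable_fun setT (fun t => tsum (a ^~ t) (x t)).
Proof.
move=> ma mx; apply/measurable_fun_tnthP => j /=.
rewrite (_ : _ \o _ = fun t => \sum_(i < n) a i t * tnth (tnth (x t) i) j).
  apply: measurable_sum => i; apply: measurable_funM => //.
  have m1 : measurable_fun setT (fun t => tnth (x t) i).
    by apply: (@measurableT_comp _ _ _ _ _ _ (fun z : n.-tuple (p.-tuple R)
      => tnth z i)) => //; exact: measurable_tnth.
  by apply: (@measurableT_comp _ _ _ _ _ _ (fun z : p.-tuple R => tnth z j))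
    => //; exact: measurable_tnth.
by apply/funext => t; rewrite /= tnth_mktuple.
Qed.

(** A weighted sum of independent standard Gaussian vectors is distributed as
    the Euclidean norm of the weights times a standard Gaussian vector. *)
Lemma gaussian_weighted_sum (n : nat) (a : 'I_n -> R) (G : p.-tuple R -> \bar R) :
  measurable_fun setT G -> (forall x, 0 <= G x)%E ->
  (\int[iid nu n]_x G (tsum a x) =
   \int[nu]_z G (tscale (Num.sqrt (\sum_(i < n) a i ^+ 2)) z))%E.
Proof.
elim: n a G => [|n IH] a G mG G0.
  have zE : tscale 0 = tsum a \o (fun=> [tuple]) :> (p.-tuple R -> _).
    by apply/funext => z; apply: eq_from_tnth => j;
      rewrite /= !tnth_mktuple big_ord0 mul0r.
  rewrite big_ord0 sqrtr0 /= integral_dirac//; last first.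
    apply: measurableT_comp => //;
      apply: (@measurable_funtsum _ _ _ (fun i _ => a i)) => //.
  rewrite diracE mem_set// mul1e.
  under [RHS]eq_integral do rewrite zE /=.
  by rewrite integral_cst//= [X in (_ * X)%E](@probability_setT _ _ _ nu) mule1.
have mts : measurable_fun setT (fun x : n.+1.-tuple (p.-tuple R) => G (tsum a x)).
  by apply: measurableT_comp => //;
    exact: (@measurable_funtsum _ _ _ (fun i _ => a i)).
rewrite ge0_integral_iidS//.
pose a' (i : 'I_n) := a (lift ord0 i); pose c := Num.sqrt (\sum_(i < n) a' i ^+ 2).
transitivity (\int[nu]_u \int[nu]_z G (tcomb (a ord0) c u z))%E.
  apply: eq_integral => u _.
  transitivity (\int[iid nu n]_x G (tcomb (a ord0) 1 u (tsum a' x)))%E.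
    apply: eq_integral => x _; congr (G _); apply: eq_from_tnth => j.
    rewrite !tnth_mktuple big_ord_recl mul1r; congr (_ + _).
    by apply: eq_bigr => i _; rewrite tnthS.
  rewrite (IH a' (fun y => G (tcomb (a ord0) 1 u y)))//; last first.
    by apply: measurableT_comp => //; exact: measurable_funcomb.
  apply: eq_integral => z _; congr (G _); apply: eq_from_tnth => j.
  by rewrite !tnth_mktuple mul1r.
rewrite gaussian_rotation//; apply: eq_integral => z _;
  congr (G (tscale (Num.sqrt _) z)).
rewrite big_ord_recl; congr (_ + _); rewrite sqr_sqrtr//.
by apply: sumr_ge0 => i _; exact: sqr_ge0.
Qed.

End weighted_sum.

(** * Euclidean norm and proximal map *)

Section euclidean_facts.
Context {R : realType} {p : nat}.
Implicit Types u v w : 'rV[R]_p.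

Lemma enorm_sqrD u v :
  enorm (u + v) ^+ 2 = enorm u ^+ 2 + 2 * dot u v + enorm v ^+ 2.
Proof.
rewrite !enorm_sqr /dot mulr_sumr -!big_split/=.
by apply: eq_bigr => j _; rewrite !mxE; ring.
Qed.

Lemma enorm_sqrZ (c : R) u : enorm (c *: u) ^+ 2 = c ^+ 2 * enorm u ^+ 2.
Proof.
by rewrite !enorm_sqr mulr_sumr; apply: eq_bigr => j _; rewrite !mxE; ring.
Qed.

Lemma enormZ (c : R) u : enorm (c *: u) = `|c| * enorm u.
Proof.
apply/eqP; rewrite -(@eqrXn2 _ 2)//;
  first by rewrite enorm_sqrZ exprMn real_normK ?num_real.
- exact: enorm_ge0.
- by rewrite mulr_ge0// enorm_ge0.
Qed.

Lemma enormN u : enorm (- u) = enorm u.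
Proof. by rewrite -scaleN1r enormZ normrN1 mul1r. Qed.

Lemma dotZr (c : R) u v : dot u (c *: v) = c * dot u v.
Proof. by rewrite /dot mulr_sumr; apply: eq_bigr => j _; rewrite !mxE; ring. Qed.

Lemma dotZl (c : R) u v : dot (c *: u) v = c * dot u v.
Proof. by rewrite /dot mulr_sumr; apply: eq_bigr => j _; rewrite !mxE; ring. Qed.

Lemma dot_le_sqr u v : 2 * dot u v <= enorm u ^+ 2 + enorm v ^+ 2.
Proof.
have := enorm_sqrD u (- v); rewrite enormN -scaleN1r dotZr.
have := sqr_ge0 (enorm (u + -1 *: v)); lra.
Qed.

Lemma cauchy_schwarz u v : dot u v <= enorm u * enorm v.
Proof.
have [u0|u0] := eqVneq (enorm u) 0; last have [v0|v0] := eqVneq (enorm v) 0.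
- apply: (@le_trans _ _ 0); last by rewrite u0 mul0r.
  rewrite leNgt; apply/negP => d0.
  pose c := (enorm v ^+ 2 + 1) / dot u v.
  have := dot_le_sqr (c *: u) v; rewrite dotZl enorm_sqrZ u0 expr0n mulr0 add0r.
  rewrite /c divfK ?gt_eqF//; have := sqr_ge0 (enorm v); lra.
- apply: (@le_trans _ _ 0); last by rewrite v0 mulr0.
  rewrite leNgt; apply/negP => d0.
  pose c := (enorm u ^+ 2 + 1) / dot u v.
  have := dot_le_sqr u (c *: v); rewrite dotZr enorm_sqrZ v0 expr0n mulr0 addr0.
  rewrite /c divfK ?gt_eqF//; have := sqr_ge0 (enorm u); lra.
have up : 0 < enorm u by rewrite lt_neqAle eq_sym u0 enorm_ge0.
have vp : 0 < enorm v by rewrite lt_neqAle eq_sym v0 enorm_ge0.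
have := dot_le_sqr ((enorm u)^-1 *: u) ((enorm v)^-1 *: v).
rewrite dotZl dotZr !enorm_sqrZ -!exprMn !mulVf// expr1n => h.
have : (enorm u)^-1 * ((enorm v)^-1 * dot u v) <= 1 by lra.
by rewrite ler_pdivrMl// mulr1 ler_pdivrMl// mulrC.
Qed.

Lemma dot_cross_difference (x y u v : 'rV[R]_p) :
  dot (x - u) (v - u) + dot (y - v) (u - v) =
  enorm (u - v) ^+ 2 - dot (x - y) (u - v).
Proof.
rewrite enorm_sqr /dot -big_split/= -sumrB; apply: eq_bigr => j _.
by rewrite !mxE; ring.
Qed.

Lemma enorm_triangle u v : enorm (u + v) <= enorm u + enorm v.
Proof.
rewrite -(@ler_pXn2r _ 2) ?nnegrE ?addr_ge0 ?enorm_ge0//.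
by rewrite enorm_sqrD sqrrD lerD2r lerD2l -[leRHS]mulr_natl ler_wpM2l//
  cauchy_schwarz.
Qed.

Lemma enorm_reverse_triangle u v : `|enorm u - enorm v| <= enorm (u - v).
Proof.
have h1 := enorm_triangle (u - v) v; rewrite subrK in h1.
have h2 := enorm_triangle (v - u) u; rewrite subrK -opprB enormN in h2.
by rewrite ler_norml; apply/andP; split; lra.
Qed.

End euclidean_facts.

Section prox_lipschitz.
Context {R : realType} {p : nat} (h : 'rV[R]_p -> \bar R).
Hypotheses (h_proper : proper_fun h) (h_convex : convex_fun h).
Hypothesis prox_exists : forall x, argmin (prox_objective h x) !=set0.

Lemma prox_argmin x : argmin (prox_objective h x) (prox h x).
Proof. by have [b bmin] := prox_exists x; exact: xgetI bmin. Qed.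

Lemma prox_fin_num x : h (prox h x) \is a fin_num.
Proof.
have [hNy [x0 hx0]] := h_proper.
have := prox_argmin x x0; rewrite /prox_objective.
have := hNy x0; move: (h x0) hx0 => [r0||]// _ _.
have := hNy (prox h x); case: (h (prox h x)) => [r||]//.
Qed.

(** First-order optimality of the proximal point, up to a term that vanishes
    with [l]: compare it with the point at fraction [l] of the way to [q]. *)
Lemma prox_variational x q (a b l : R) : h (prox h x) = a%:E -> h q = b%:E ->
  0 < l -> l < 1 ->
  a - b <= - dot (x - prox h x) (q - prox h x) + l / 2 * enorm (q - prox h x) ^+ 2.
Proof.
set P := prox h x => hP hq l0 l1.
have := prox_argmin x (l *: q + (1 - l) *: P); rewrite -/P /prox_objective hP.
have := h_convex q P (ltW l0) (ltW l1); rewrite hP hq -!EFinM -EFinD.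
have [hNy _] := h_proper; have := hNy (l *: q + (1 - l) *: P).
case: (h _) => [r||]// _; rewrite lee_fin => hr; rewrite -!EFinD lee_fin.
have -> : x - (l *: q + (1 - l) *: P) = (x - P) + (- l) *: (q - P).
  by apply/rowP => j; rewrite !mxE; ring.
rewrite (enorm_sqrD (x - P)) dotZr enorm_sqrZ => H.
(* The comparison of objectives is the claim multiplied by [l]. *)
rewrite -(@ler_pM2l _ l)//.
set D := enorm (q - P) ^+ 2 in H *; set S := dot _ _ in H *.
have -> : l * (- S + l / 2 * D) = - (l * S) + l ^+ 2 * D / 2 by ring.
rewrite sqrrN in H; lra.
Qed.

(** Adding the optimality conditions at [x] and at [y] gives
    [(1 - l) |v|^2 <= (x - y) . v] with [v] the difference of the proximal points;
    [l] tends to 0, and then [(x - y) . v <= (|x - y|^2 + |v|^2) / 2]. *)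
Lemma prox_nonexpansive x y : enorm (prox h x - prox h y) <= enorm (x - y).
Proof.
have /fineK hP := prox_fin_num x; have /fineK hQ := prox_fin_num y.
set P := prox h x in hP *; set Q := prox h y in hQ *.
set a := fine (h P) in hP; set b := fine (h Q) in hQ.
set v := P - Q.
have key (l : R) : 0 < l -> l < 1 -> (1 - l) * enorm v ^+ 2 <= dot (x - y) v.
  move=> l0 l1.
  have h1 := prox_variational (esym hP) (esym hQ) l0 l1.
  have h2 := prox_variational (esym hQ) (esym hP) l0 l1.
  rewrite -/P -/Q in h1 h2.
  have e1 : enorm (Q - P) = enorm v by rewrite -opprB enormN.
  rewrite e1 in h1; rewrite -/v in h2.
  have e2 := dot_cross_difference x y P Q; rewrite -/v in e2.
  rewrite mulrBl mul1r; move: h1 h2 e2; clear.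
  move: (enorm v ^+ 2) (dot (x - y) v) (dot (x - P) (Q - P)) (dot (y - Q) v).
  move=> D S s1 s2; lra.
have S0 : 0 <= dot (x - y) v.
  have h0 : 0 < (2^-1 : R) by rewrite invr_gt0.
  have h1 : (2^-1 : R) < 1 by rewrite invf_lt1// ltr1n.
  apply: le_trans (key _ h0 h1); rewrite mulr_ge0 ?sqr_ge0//; lra.
have D : enorm v ^+ 2 <= dot (x - y) v.
  apply: le_of_scaled => // l l0 l1.
  have := key (1 - l); have -> : 1 - (1 - l) = l by ring.
  apply; lra.
rewrite -(@ler_pXn2r _ 2) ?nnegrE ?enorm_ge0//.
have := dot_le_sqr (x - y) v; lra.
Qed.

End prox_lipschitz.

(** * Error of the proximal point under random noise *)

Lemma integral_probability_cst {d} {T : measurableType d} {R : realType}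
  (Q : probability T R) (q : \bar R) : (\int[Q]_x q = q)%E.
Proof. by rewrite integral_cst//= [X in (_ * X)%E](@probability_setT _ _ _ Q)
  mule1. Qed.

Section joint_law.
Context {d d1 d2} {Omega : measurableType d} {T1 : measurableType d1}
  {T2 : measurableType d2} {R : realType}.
Variables (P : probability Omega R) (U : {RV P >-> T1}) (V : {RV P >-> T2}).

(** The random pair formed by [U] and [V]. *)
Definition pair_RV (w : Omega) : T1 * T2 := (U w, V w).

Lemma measurable_pair_RV : measurable_fun setT pair_RV.
Proof. by apply/measurable_fun_pairP; split; exact: measurable_funP. Qed.

HB.instance Definition _ :=
  isMeasurableFun.Build _ _ _ _ pair_RV measurable_pair_RV.

(** If [U] has law [mu] and is independent of [V], then the probability of an
    event in [(U, V)] is bounded by any bound on the [mu]-measure of its sections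
    at fixed values of [V]. *)
Lemma independent_section_bound (mu : probability T1 R) (C : set (T1 * T2))
  (q : R) :
  (forall A, measurable A -> P (U @^-1` A) = mu A) -> independent P U V ->
  measurable C -> (forall v, (mu (ysection C v) <= q%:E)%E) ->
  (P (pair_RV @^-1` C) <= q%:E)%E.
Proof.
move=> Umu UV mC Cq.
have <- : (mu \x distribution P V)%E C = P (pair_RV @^-1` C).
  apply: (@product_measure_unique _ _ _ _ _ mu (distribution P V)
    (distribution P pair_RV)) => //.
  move=> A B mA mB; rewrite /distribution /pushforward/= -Umu// -UV//.
rewrite -[X in (_ \x _)%E X]setTI setIC -integral_indic//.
rewrite indic_fubini_tonelli1// indic_fubini_tonelli// indic_fubini_tonelli_GE//.
apply: (@le_trans _ _ (\int[distribution P V]_v q%:E)%E).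
  by apply: ge0_le_integral => //=; exact: measurable_fun_ysection.
by rewrite integral_probability_cst.
Qed.

End joint_law.

Section weighted_sum_law.
Context {R : realType} {p : nat}.
Local Notation nu := (std_gaussian p).

Lemma gaussian_weighted_sum_law (n : nat) (a : 'I_n -> R) (B : set (p.-tuple R)) :
  measurable B -> \sum_(i < n) a i ^+ 2 = 1 -> iid nu n (tsum a @^-1` B) = nu B.
Proof.
move=> mB a1.
have mts : measurable_fun setT (tsum a : n.-tuple (p.-tuple R) -> _).
  exact: (@measurable_funtsum _ _ _ _ _ (fun i _ => a i)).
have mtB : measurable (tsum a @^-1` B) by rewrite -[X in measurable X]setTI;
  exact: mts.
rewrite -[in LHS](setIT (tsum a @^-1` B)) -integral_indic//.
rewrite -[in RHS](setIT B) -integral_indic//.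
have := @gaussian_weighted_sum R p n a (fun z => (\1_B z)%:E).
rewrite a1 sqrtr1 => H.
transitivity (\int[nu]_z (\1_B (tscale 1 z))%:E)%E.
  by rewrite -H//; apply/measurable_EFinP; exact: measurable_indic.
apply: eq_integral => z _; congr (\1_B _)%:E.
by apply: eq_from_tnth => j; rewrite tnth_mktuple mul1r.
Qed.

End weighted_sum_law.

Section prox_error.
Context {R : realType} {n p : nat}.
Variables (h : 'rV[R]_p -> \bar R) (beta0 : 'rV[R]_p).
Hypotheses (h_proper : proper_fun h) (h_convex : convex_fun h).
Hypothesis prox_exists : forall x, argmin (prox_objective h x) !=set0.
Local Notation nu := (std_gaussian p).

(** The error of the proximal point for the noise vector [s z]. *)
Definition prox_error (s : R) (z : p.-tuple R) : R :=
  enorm (prox h (beta0 + s *: tvec z) - beta0).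

(** The root mean square of that error for a standard Gaussian [z]. *)
Definition prox_rms (s : R) : R := Num.sqrt (\int[nu]_z (prox_error s z ^+ 2)).

Lemma prox_riskE (s : R) :
  Num.sqrt (prox_risk n h beta0 s) = prox_rms (s / Num.sqrt n%:R).
Proof.
rewrite /prox_risk /prox_rms unlock; congr (Num.sqrt (fine _)).
by apply: eq_integral => z _; rewrite /prox_error -opprB enormN.
Qed.

Lemma prox_error_lipschitz (s : R) : 0 <= s -> lipschitz_enorm s (prox_error s).
Proof.
move=> s0 x y; rewrite /prox_error.
apply: (le_trans (enorm_reverse_triangle _ _)); rewrite opprB addrA subrK.
apply: (le_trans (prox_nonexpansive h_proper h_convex prox_exists _ _)).
have -> : beta0 + s *: tvec x - (beta0 + s *: tvec y) = s *: (tvec x - tvec y).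
  by apply/rowP => j; rewrite !mxE; ring.
by rewrite enormZ ger0_norm.
Qed.

(* [prox_error] as a function of the point where the proximal map is taken. *)
Let shift (q : p.-tuple R) : R := enorm (prox h (tvec q) - beta0).

Let shift_lipschitz : lipschitz_enorm 1 shift.
Proof.
move=> x y; rewrite mul1r.
apply: (le_trans (enorm_reverse_triangle _ _)); rewrite opprB addrA subrK.
exact: prox_nonexpansive.
Qed.

Lemma measurable_prox_error {d} {T : measurableType d} (s : T -> R) (z : T ->
  p.-tuple R) :
  measurable_fun setT s -> measurable_fun setT z ->
  measurable_fun setT (fun t => prox_error (s t) (z t)).
Proof.
move=> ms mz.
pose b0 : p.-tuple R := [tuple beta0 0 j | j < p].
pose q t := tcomb 1 1 b0 (tscale (s t) (z t)).
have mq : measurable_fun setT q.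
  by apply: measurable_funcomb => //; exact: measurable_funscale.
have qE t : beta0 + s t *: tvec (z t) = tvec (q t).
  by apply/rowP => j; rewrite !mxE !tnth_mktuple !mul1r.
have -> : (fun t => prox_error (s t) (z t)) = shift \o q.
  by apply/funext => t; rewrite /prox_error qE.
apply: measurableT_comp => //.
exact: measurable_lipschitz ler01 shift_lipschitz.
Qed.

Lemma measurable_prox_rms : measurable_fun setT prox_rms.
Proof.
apply: (@measurableT_comp _ _ _ _ _ _ (@Num.sqrt R)).
  by apply: continuous_measurable_fun; exact: sqrt_continuous.
apply: (@measurableT_comp _ _ _ _ _ _ (@fine R)) => //.
apply: (@measurable_fun_fubini_tonelli_F _ _ R _ _ nu
  (fun sz => (prox_error sz.1 sz.2 ^+ 2)%:E)).
  by apply/measurable_EFinP; apply: measurable_funX; exact: measurable_prox_error.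
by move=> sz; rewrite lee_fin sqr_ge0.
Qed.

(** The size [sigma / sqrt n] of the Gaussian perturbation and the weights of the
    design vectors in [Z], as functions of the noise [e]. *)
Definition level (e : n.-tuple R) : R := noise_level (tnth e) / Num.sqrt n%:R.

Definition weight (i : 'I_n) (e : n.-tuple R) : R :=
  (Num.sqrt n%:R * noise_level (tnth e))^-1 * tnth e i.

(** The event that the error at the noise [Z] computed from the design [x] and
    the noise [e] is far from its root mean square. *)
Definition far_event (t : R) : set (n.-tuple (p.-tuple R) * n.-tuple R) :=
  [set xe | level xe.2 * (t + 1) <
     `|prox_error (level xe.2) (tsum (weight ^~ xe.2) xe.1)
       - prox_rms (level xe.2)|].

Lemma level_ge0 e : 0 <= level e.
Proof. by rewrite divr_ge0// sqrtr_ge0. Qed.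

Lemma measurable_noise_level : measurable_fun setT (fun e :
  n.-tuple R => noise_level (tnth e)).
Proof.
apply: (@measurableT_comp _ _ _ _ _ _ (@Num.sqrt R)).
  by apply: continuous_measurable_fun; exact: sqrt_continuous.
apply: measurable_funM => //; apply: measurable_sum => i.
by apply: measurable_funX; exact: measurable_tnth.
Qed.

Lemma measurable_level : measurable_fun setT level.
Proof. by apply: measurable_funM => //; exact: measurable_noise_level. Qed.

Lemma measurable_weight (i : 'I_n) : measurable_fun setT (weight i).
Proof.
pose c (e : n.-tuple R) : R := Num.sqrt n%:R * noise_level (tnth e).
have mc : measurable_fun setT c.
  by apply: measurable_funM => //; exact: measurable_noise_level.
(* The inverse of a nonnegative function is its power of exponent -1. *)
have cV : (fun e => (c e)^-1) = (@powR R ^~ (- 1)) \o c.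
  apply/funext => e /=; rewrite powR_inv1//.
  by rewrite mulr_ge0// sqrtr_ge0.
have mcV : measurable_fun setT (fun e => (c e)^-1).
  rewrite cV; have mp := @measurable_powR R (- 1).
  exact: (@measurableT_comp _ _ _ _ _ _ (@powR R ^~ (- 1)) _ c mp mc).
by apply: (measurable_funM mcV); exact: measurable_tnth.
Qed.

Lemma measurable_far_event (t : R) : measurable (far_event t).
Proof.
have ml : measurable_fun setT (fun xe : n.-tuple (p.-tuple R)
  * n.-tuple R => level xe.2).
  by apply: measurableT_comp => //; exact: measurable_level.
have mf : measurable_fun setT (fun xe : n.-tuple (p.-tuple R) * n.-tuple R =>
    level xe.2 * (t + 1)) by exact: measurable_funM.
have mg : measurable_fun setT (fun xe : n.-tuple (p.-tuple R) * n.-tuple R =>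
    `|prox_error (level xe.2) (tsum (weight ^~ xe.2) xe.1)
      - prox_rms (level xe.2)|).
  apply: measurableT_comp => //; apply: measurable_funB.
    apply: measurable_prox_error => //.
    apply: (@measurable_funtsum R p _ _ n (fun i xe => weight i xe.2)) => //.
    by move=> i; apply: measurableT_comp => //; exact: measurable_weight.
  by apply: measurableT_comp => //; exact: measurable_prox_rms.
have mb := measurable_fun_ltr mf mg.
have := mb measurableT [set true]; by rewrite setTI; exact.
Qed.

Lemma weight_sum1 e : 0 < level e -> \sum_(i < n) weight i e ^+ 2 = 1.
Proof.
rewrite /level => l0.
have [n0|n0] := posnP n.
  have nR : n%:R = 0 :> R by rewrite n0.
  by move: l0; rewrite nR sqrtr0 invr0 mulr0 ltxx.
have nl0 : 0 < noise_level (tnth e).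
  rewrite lt_neqAle sqrtr_ge0 andbT; apply/eqP => nl.
  by move: l0; rewrite -nl mul0r ltxx.
have nr : (0 : R) < n%:R by rewrite ltr0n.
have nl2 : noise_level (tnth e) ^+ 2 = n%:R^-1 * \sum_(i < n) tnth e i ^+ 2.
  by rewrite sqr_sqrtr// mulr_ge0// sumr_ge0// => i _; exact: sqr_ge0.
rewrite /weight; under eq_bigr do rewrite exprMn.
rewrite -mulr_sumr exprVn exprMn sqr_sqrtr ?ltW//.
have -> : \sum_(i < n) tnth e i ^+ 2 = n%:R * noise_level (tnth e) ^+ 2.
  by rewrite nl2 mulVKf// gt_eqF.
by rewrite mulVf// mulf_neq0 ?gt_eqF// exprn_gt0.
Qed.

(** For a fixed noise, [Z] is a standard Gaussian vector and the concentration
    bound applies; at noise level 0 the error is constant. *)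
Lemma far_event_section (t : R) (e : n.-tuple R) : 0 < t ->
  (iid nu n (ysection (far_event t) e) <= (2 * expR (- (t ^+ 2 / 2)))%:E)%E.
Proof.
move=> t0; have := level_ge0 e; rewrite le_eqVlt => /orP[/eqP l0|l0].
  rewrite (_ : ysection _ _ = set0) ?measure0 ?lee_fin ?mulr_ge0 ?expR_ge0//.
  apply/seteqP; split => // x; rewrite /ysection/= inE /far_event/= -l0 mul0r.
  rewrite /prox_rms /prox_error; under eq_Rintegral do rewrite scale0r addr0.
  rewrite scale0r addr0 Rintegral_cst//= probability_setT/= mulr1 sqrtr_sqr.
  by rewrite (ger0_norm (enorm_ge0 _)) subrr normr0 ltxx.
pose B := [set z | level e * (t + 1) <
  `|prox_error (level e) z - prox_rms (level e)|].
have mB : measurable B.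
  have mg : measurable_fun setT (fun z : p.-tuple R =>
      `|prox_error (level e) z - prox_rms (level e)|).
    by apply: measurableT_comp => //; apply: measurable_funB => //;
      exact: measurable_prox_error.
  have mb := measurable_fun_ltr (@measurable_cst _ _ _ _ setT (level e * (t +
    1))) mg.
  have := mb measurableT [set true]; by rewrite setTI; exact.
rewrite (_ : ysection _ _ = tsum (weight ^~ e) @^-1` B); last first.
  by apply/seteqP; split => x; rewrite /ysection/= inE.
rewrite (gaussian_weighted_sum_law mB)//; last exact: weight_sum1.
have F0 z : 0 <= prox_error (level e) z by exact: enorm_ge0.
have FL := prox_error_lipschitz (ltW l0).
by have := gaussian_rms_concentration l0 FL F0 t0; rewrite -/(prox_rms (level e)).
Qed.

End prox_error.

(** * Deviation of the penalized least-squares error *)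

Theorem theorem4p1 (R : realType) (n p : nat)
  (d : measure_display) (Omega : measurableType d) (P : probability Omega R)
  (X : 'I_n -> {RV P >-> p.-tuple R}) (eps : 'I_n -> {RV P >-> R})
  (Y : 'I_n -> Omega -> R) (beta0 : 'rV[R]_p)
  (h : 'rV[R]_p -> \bar R) (betahat : Omega -> 'rV[R]_p)
  (sigma : Omega -> R) (Z eta : Omega -> 'rV[R]_p)
  (X_gaussian : forall i, has_law (X i) (std_gaussian p))
  (X_indep : mutually_independent P X)
  (X_eps_indep : independent P (fun w => [tuple X i w | i < n])
                               (fun w => [tuple eps i w | i < n]))
  (Y_def : forall i w, Y i w = dot (tvec (X i w)) beta0 + eps i w)
  (h_proper : proper_fun h) (h_convex : convex_fun h)
  (prox_exists : forall x, argmin (prox_objective h x) !=set0)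
  (sigma_def : forall w, sigma w = noise_level (eps ^~ w))
  (sigma_gt0 : {ae P, forall w, 0 < sigma w})
  (Z_def : forall w,
    Z w = noise_vector (fun i => tvec (X i w)) (eps ^~ w))
  (eta_def : forall w,
    eta w = prox h (beta0 + (sigma w / Num.sqrt n%:R) *: Z w))
  (betahat_min : {ae P, forall w,
    argmin (penalized_lsq h (fun i => tvec (X i w)) (Y ^~ w)) (betahat w)}) :
  forall t : R, 0 < t ->
  with_probability_at_least P (1 - 2 * expR (- (t ^+ 2 / 2)))
    [set w | `| enorm (betahat w - beta0)
                - Num.sqrt (prox_risk n h beta0 (sigma w)) |
             <= sigma w * (t + 1) / Num.sqrt n%:R
                + enorm (betahat w - eta w)].
Proof.
move=> t t0.
pose U : {RV P >-> n.-tuple (p.-tuple R)} := tuple_RV X.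
pose V : {RV P >-> n.-tuple R} := tuple_RV eps.
pose C := far_event h beta0 t : set (n.-tuple (p.-tuple R) * n.-tuple R).
have mC : measurable C by exact: measurable_far_event.
have mC' : measurable (pair_RV U V @^-1` C).
  by rewrite -[X in measurable X]setTI; exact: measurable_pair_RV.
exists (~` (pair_RV U V @^-1` C)); split.
- exact: measurableC.
- have levelE w : level (V w) = sigma w / Num.sqrt n%:R.
    rewrite /level sigma_def; congr (noise_level _ / _).
    by apply/funext => i; rewrite tnth_mktuple.
  have ZE w : tvec (tsum (weight ^~ (V w)) (U w)) = Z w.
    rewrite Z_def /noise_vector; apply/rowP => j.
    rewrite !mxE tnth_mktuple summxE mulr_sumr; apply: eq_bigr => i _.
    rewrite !mxE /weight !tnth_mktuple mulrA; congr ((_ * noise_level _)^-1 * _ * _).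
    by apply/funext => k; rewrite tnth_mktuple.
  move=> w /=; rewrite /C /far_event/= levelE => /negP; rewrite -leNgt.
  rewrite /prox_error ZE -eta_def prox_riskE mulrAC => H.
  have := enorm_reverse_triangle (betahat w - beta0) (eta w - beta0).
  rewrite opprB addrA subrK => H2.
  apply: (le_trans (ler_distD (enorm (eta w - beta0)) _ _)).
  by rewrite addrC lerD.
have Ulaw A : measurable A -> P (U @^-1` A) = iid (std_gaussian p) n A.
  by move=> mA; exact: law_tuple_iid.
have UV : independent P U V by exact: X_eps_indep.
have Csec e : (iid (std_gaussian p) n (ysection C e)
    <= (2 * expR (- (t ^+ 2 / 2)))%:E)%E.
  exact: far_event_section.
have := independent_section_bound Ulaw UV mC Csec.
by rewrite probability_setC// EFinB => H; apply: leeB.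
Qed.
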